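(* Let $N\ge 3$, $k\in\mathbb{N}$, $k\ge 1$, let $a_1,\dots,a_k\in\mathbb{R}^N$ with $a_i\ne a_j$ for $i\ne j$, and let $h_1,\dots,h_k\in C^1(\mathbb{S}^{N-1})$. Suppose that there exists a positive classical solution $v$ in $\mathbb{R}^N\setminus\{a_1,\dots,a_k\}$ of $$-\Delta v-\sum_{i=1}^k\frac{h_i\big(\frac{x-a_i}{|x-a_i|}\big)}{|x-a_i|^2}\,v=v^{2^*-1},\qquad v>0\quad\text{in }\mathbb{R}^N\setminus\{a_1,\dots,a_k\}.$$ Then the quadratic form $$\mathcal{Q}(u)=\int_{\mathbb{R}^N}|\nabla u|^2\,dx-\sum_{i=1}^k\int_{\mathbb{R}^N}\frac{h_i\big(\frac{x-a_i}{|x-a_i|}\big)}{|x-a_i|^2}\,u^2(x)\,dx$$ is positive semidefinite on $\mathcal{D}^{1,2}(\mathbb{R}^N)$, i.e. $\mathcal{Q}(u)\ge 0$ for all $u\in\mathcal{D}^{1,2}(\mathbb{R}^N)$.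
   Context: $2^*=\frac{2N}{N-2}$. $\mathcal{D}^{1,2}(\mathbb{R}^N)$ is the closure of $C_0^\infty(\mathbb{R}^N)$ with respect to the norm $\|u\|_{\mathcal{D}^{1,2}(\mathbb{R}^N)}=\big(\int_{\mathbb{R}^N}|\nabla u|^2dx\big)^{1/2}$. A classical solution is a $C^2$ function on $\mathbb{R}^N\setminus\{a_1,\dots,a_k\}$ satisfying the equation pointwise there; no integrability or behaviour near the points $a_i$ or at infinity is assumed. *)

(* Defs.v *)
From HB Require Import structures.
From mathcomp Require Import all_boot all_order all_algebra.
From mathcomp Require Import all_classical all_reals all_analysis.

Set Implicit Arguments.
Unset Strict Implicit.
Unset Printing Implicit Defensive.

Import Order.TTheory GRing.Theory Num.Theory.
Import numFieldNormedType.Exports.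

Local Open Scope classical_set_scope.
Local Open Scope ring_scope.

(* Row vectors carry the sigma-algebra generated by the coordinates, as tuples
   do in the library. *)
Definition measure_rV_display : measure_display -> measure_display.
Proof. exact. Qed.

Section measurable_rV.
Context {d} {T : sigmaRingType d}.
Variable n : nat.

Let coors : 'I_n -> 'rV[T]_n -> T := fun i x => x ord0 i.

Let rV_set0 : g_sigma_preimage coors set0.
Proof. exact: sigma_algebra0. Qed.

Let rV_setC A : g_sigma_preimage coors A -> g_sigma_preimage coors (~` A).
Proof. exact: sigma_algebraC. Qed.

Let rV_bigcup (F : _^nat) : (forall i, g_sigma_preimage coors (F i)) ->
  g_sigma_preimage coors (\bigcup_i (F i)).
Proof. exact: sigma_algebra_bigcup. Qed.

HB.instance Definition _ := @isMeasurable.Build (measure_rV_display d)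
  'rV[T]_n (g_sigma_preimage coors) rV_set0 rV_setC rV_bigcup.

End measurable_rV.

Lemma measurable_coord_rV d (T : sigmaRingType d) n (i : 'I_n) :
  measurable_fun [set: 'rV[T]_n] (fun x : 'rV[T]_n => x ord0 i).
Proof.
move=> _ Y mY; rewrite setTI; apply: sub_sigma_algebra => /=.
rewrite -bigcup_seq/=; exists i => /=; first by rewrite mem_index_enum.
by exists Y => //; rewrite setTI.
Qed.

Lemma measurable_fun_rVP d1 d2 (T1 : measurableType d1) (T2 : measurableType d2)
    n (f : T1 -> 'rV[T2]_n) :
  measurable_fun [set: T1] f <->
  forall i, measurable_fun [set: T1] (fun x => f x ord0 i).
Proof.
split=> [mf i|mf].
  apply: (@measurableT_comp _ _ _ _ _ _ (fun x : 'rV[T2]_n => x ord0 i)) => //.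
  exact: measurable_coord_rV.
pose G := \big[setU/set0]_(i < n)
  preimage_set_system setT (fun x : 'rV[T2]_n => x ord0 i) measurable.
have mE : (measurable : set (set 'rV[T2]_n)) = <<s G >> by [].
apply: (@measurability _ _ _ _ _ _ G) => // _ [B GB <-]; rewrite setTI.
move: GB; rewrite /G -bigcup_seq => -[i _ [A mA <-]].
rewrite setTI -[X in measurable X]setTI.
exact: mf.
Qed.

Section lebesgue_rV.
Context {R : realType}.

Definition rV_cons n (p : 'rV[R]_n * R) : 'rV[R]_n.+1 :=
  \row_i oapp (fun j => p.1 ord0 j) p.2 (unlift ord0 i).

Lemma measurable_rV_cons n :
  measurable_fun [set: 'rV[R]_n * R] (@rV_cons n).
Proof.
apply/measurable_fun_rVP => i.
have -> : (fun p => @rV_cons n p ord0 i) =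
    (fun p => oapp (fun j => p.1 ord0 j) p.2 (unlift ord0 i)).
  by apply/funext => p; rewrite mxE.
case: unliftP => [j _|_] /=; last exact: measurable_snd.
apply: (@measurableT_comp _ _ _ _ _ _ (fun x : 'rV[R]_n => x ord0 j)) => //.
exact: measurable_coord_rV.
Qed.

Section step.
Variables (n : nat) (mu : {measure set 'rV[R]_n -> \bar R}).

Definition lebesgue_rV_step : set 'rV[R]_n.+1 -> \bar R :=
  pushforward (mu \x (@lebesgue_measure R))%E (@rV_cons n).

Let step0 : lebesgue_rV_step set0 = 0%E.
Proof. by rewrite /lebesgue_rV_step /pushforward preimage_set0 measure0. Qed.

Let step_ge0 A : (0 <= lebesgue_rV_step A)%E.
Proof. by rewrite /lebesgue_rV_step /pushforward measure_ge0. Qed.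

Let step_sigma_additive : semi_sigma_additive lebesgue_rV_step.
Proof.
move=> F mF tF mUF; rewrite /lebesgue_rV_step /pushforward preimage_bigcup.
apply: measure_semi_sigma_additive.
- by move=> i; rewrite -[X in measurable X]setTI; exact: measurable_rV_cons.
- apply/trivIsetP => /= i j _ _ ij; rewrite -preimage_setI.
  by move/trivIsetP : tF => /(_ _ _ _ _ ij) ->//; rewrite preimage_set0.
- rewrite -preimage_bigcup -[X in measurable X]setTI.
  exact: measurable_rV_cons.
Qed.

HB.instance Definition _ := isMeasure.Build _ _ _ lebesgue_rV_step
  step0 step_ge0 step_sigma_additive.

End step.

Fixpoint lebesgue_rV n : {measure set 'rV[R]_n -> \bar R} :=
  match n with
  | 0 => dirac (0 : 'rV[R]_0)
  | n'.+1 => lebesgue_rV_step (lebesgue_rV n')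
  end.

Lemma lebesgue_rV_box n (A : 'I_n -> set R) :
  (forall i, measurable (A i)) ->
  (lebesgue_rV n [set x | forall i, A i (x ord0 i)] =
   \prod_(i < n) lebesgue_measure (A i))%E.
Proof.
elim: n A => [A _|n IH A mA] /=.
  rewrite big_ord0 diracE mem_set//.
  by move=> -[].
rewrite big_ord_recl muleC -IH => [|i]; last exact: mA.
rewrite -product_measure1E//.
- rewrite /lebesgue_rV_step /pushforward.
  apply: (congr1 (lebesgue_rV n \x lebesgue_measure)%E).
  apply/seteqP; split=> -[x t] /=.
    move=> H; split.
      by move=> i; have := H (lift ord0 i); rewrite mxE liftK.
    by have := H ord0; rewrite mxE unlift_none.
  move=> [Hx Ht] i; rewrite mxE.
  by case: unliftP => [j ->|->] /=; [exact: Hx|].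
- set B := (X in measurable X).
  have -> : B = \bigcap_(i in [set: 'I_n])
      ((fun x : 'rV[R]_n => x ord0 i) @^-1` (A (lift ord0 i))).
    by apply/seteqP; split=> [x Hx i _|x Hx i]; apply: Hx.
  apply: fin_bigcap_measurable => // i _.
  rewrite -[X in measurable X]setTI.
  by apply: (measurable_coord_rV i) => //; exact: mA.
- exact: mA.
Qed.

End lebesgue_rV.

Section euclidean.
Context {R : realType} {N : nat}.
Implicit Types (x : 'rV[R]_N) (f : 'rV[R]_N -> R) (A : set 'rV[R]_N).

(* The norm `|x| of the library on row vectors is the sup norm; the topology it
   defines is the Euclidean one. *)
Definition enorm x : R := Num.sqrt (\sum_(i < N) x ord0 i ^+ 2).

Definition usphere : set 'rV[R]_N := [set x | enorm x = 1].

Definition partial (i : 'I_N) f : 'rV[R]_N -> R := 'D_(delta_mx ord0 i) f.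

Definition grad f x : 'rV[R]_N := \row_i partial i f x.

Definition laplacian f x : R := \sum_(i < N) partial i (partial i f) x.

(* f is of class C^k on A; meant for open A, on which the partial derivatives
   only depend on the values of f on A. *)
Fixpoint Ck (k : nat) A f : Prop :=
  match k with
  | 0 => forall x, A x -> {for x, continuous f}
  | k'.+1 => (forall x, A x -> {for x, continuous f}) /\
      forall i : 'I_N,
        (forall x, A x -> derivable f x (delta_mx ord0 i)) /\
        Ck k' A (partial i f)
  end.

Definition test_function f : Prop :=
  (forall k, Ck k setT f) /\ compact (closure [set x | f x != 0]).

(* C^1 regularity along the submanifold S^(N-1): locally, h is the restriction
   of a C^1 function of the ambient space. *)
Definition C1_sphere (h : 'rV[R]_N -> R) : Prop :=
  forall p, usphere p ->
    exists (U : set 'rV[R]_N) (H : 'rV[R]_N -> R),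
      [/\ open U, U p, Ck 1 U H & forall x, U x -> usphere x -> H x = h x].

Definition sobolev_exponent : R := 2 * N%:R / (N%:R - 2).

Definition angular_potential (h : 'rV[R]_N -> R) (a x : 'rV[R]_N) : R :=
  h ((enorm (x - a))^-1 *: (x - a)) / enorm (x - a) ^+ 2.

(* D^{1,2}(R^N), N >= 3: the completion of the test functions for the norm
   (int |grad u|^2)^(1/2). By the Sobolev inequality, a sequence of test
   functions which is Cauchy for this norm converges in L^(2^* ), so that the
   completion is a space of (classes of) functions u, which come with a gradient
   g, the L^2 limit of the gradients; g is the weak gradient of u, hence is
   determined a.e. by u. An element is given by Borel representatives of u and
   g. *)
Record D12 := {
  D12_fun :> 'rV[R]_N -> R ;
  D12_grad : 'rV[R]_N -> 'rV[R]_N ;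
  D12_measurable_fun : measurable_fun setT D12_fun ;
  D12_measurable_grad : measurable_fun setT D12_grad ;
  D12_approx : exists phi : nat -> 'rV[R]_N -> R,
    [/\ forall n, test_function (phi n),
        Lnorm (lebesgue_rV N) 2%:E
          (fun x => (enorm (grad (phi n) x - D12_grad x))%:E)
          @[n --> \oo] --> 0%E
      & Lnorm (lebesgue_rV N) sobolev_exponent%:E
          (fun x => (phi n x - D12_fun x)%:E)
          @[n --> \oo] --> 0%E] }.

End euclidean.

Arguments D12 : clear implicits.
Arguments sobolev_exponent : clear implicits.

Section problem.
Context {R : realType} {N k : nat}.
Variables (a : 'I_k -> 'rV[R]_N) (h : 'I_k -> 'rV[R]_N -> R).

Definition positive_classical_solution (v : 'rV[R]_N -> R) : Prop :=
  [/\ Ck 2 (~` range a) v,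
      forall x, (~` range a) x -> 0 < v x
    & forall x, (~` range a) x ->
        - laplacian v x - \sum_(i < k) angular_potential (h i) (a i) x * v x
        = v x `^ (sobolev_exponent R N - 1)].

Definition Qform (u : D12 R N) : R :=
  \int[lebesgue_rV N]_x (enorm (D12_grad u x) ^+ 2)
  - \sum_(i < k)
      \int[lebesgue_rV N]_x (angular_potential (h i) (a i) x * u x ^+ 2).

End problem.

(* Main.v *)
Require Import Defs.
From HB Require Import structures.
From mathcomp Require Import all_boot all_order all_algebra.
From mathcomp Require Import all_classical all_reals all_analysis.
From mathcomp Require Import measurable_realfun.
From mathcomp Require Import ring lra.

Set Implicit Arguments.
Unset Strict Implicit.
Unset Printing Implicit Defensive.

Import Order.TTheory GRing.Theory Num.Theory.
Import numFieldNormedType.Exports.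

Local Open Scope classical_set_scope.
Local Open Scope ring_scope.

(** A positive solution v of - lap v - V v = v^(2^* - 1), where V is the sum of
    the angular potentials, is a positive supersolution of the operator
    - lap - V, and such an operator has a nonnegative quadratic form.  With
    F = - grad v / v one has, off the poles,
      div F - |F|^2 = - lap v / v = V + v^(2^* - 2) >= V.
    For psi of class C^1 with bounded support, vanishing near the poles, expand
      0 <= |grad psi + psi F|^2
         = |grad psi|^2 + div (psi^2 F) - psi^2 (div F - |F|^2)
    and integrate: the divergence integrates to 0, whence
    int V psi^2 <= int |grad psi|^2.  This argument, for an arbitrary field F, is
    divergence_form_bound, and Qform_admissible is the case of the solution v.
    Taking F = (x - a) / (2 |x - a|^2) instead gives a Hardy inequality with
    constant 4 (hardy_admissible), which is not optimal but is all that is used.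

    Nothing is known of v near the poles, so only test functions vanishing there
    may be used.  They are enough: points have zero capacity in dimension N >= 3,
    because a cutoff at scale e around a point has a gradient of order 1/e on a
    set of volume of order e^N (test_function_approx).  Hence every u of D^{1,2}
    is approximated by admissible functions psi, in the energy norm and in L^2 on
    any given set of finite measure (D12_approx_admissible).

    It remains to go to the limit in the form.  Applied to differences of
    admissible functions, the Hardy inequality extends to
    int |u - psi|^2 / |x - a_i|^2 <= 16 d when int |grad psi - g|^2 <= d, with g
    the gradient of u (hardy_D12).  As h_i is bounded on the sphere, V_i is at
    most a multiple of 1 / |x - a_i|^2, so the gradient and potential terms of the
    form at psi tend to those at u, and all of the integrals are finite. *)

(** * Borel structure of row vectors *)

Section rV_measure.
Context {R : realType}.

Lemma ler_rV_norm n (x : 'rV[R]_n) M : 0 <= M ->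
  (forall i, `|x ord0 i| <= M) <-> `|x| <= M.
Proof.
move=> M0; rewrite [`|x|]mx_normrE; split.
  move=> xM; apply/bigmax_leP; split => // -[i j] _ /=.
  by rewrite (ord1 i).
by move/bigmax_leP => [_ xM] i; exact: (xM (ord0, i)).
Qed.

Lemma ltr_rV_norm n (x : 'rV[R]_n) M : 0 < M ->
  (forall i, `|x ord0 i| < M) <-> `|x| < M.
Proof.
move=> M0; rewrite [`|x|]mx_normrE; split.
  move=> xM; apply/bigmax_ltP; split => // -[i j] _ /=.
  by rewrite (ord1 i).
by move/bigmax_ltP => [_ xM] i; exact: (xM (ord0, i)).
Qed.

Lemma coord_le_norm n (x : 'rV[R]_n) i : `|x ord0 i| <= `|x|.
Proof. by move: i; apply/ler_rV_norm. Qed.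

Lemma measurable_coord_preimage n (A : 'I_n -> set R) :
  (forall i, measurable (A i)) ->
  measurable [set x : 'rV[R]_n | forall i, A i (x ord0 i)].
Proof.
move=> mA.
have -> : [set x : 'rV[R]_n | forall i, A i (x ord0 i)] = \bigcap_(i in [set: 'I_n])
    ((fun x : 'rV[R]_n => x ord0 i) @^-1` (A i)).
  by apply/seteqP; split=> [x Hx i _|x Hx i]; apply: Hx.
apply: fin_bigcap_measurable => // i _.
rewrite -[X in measurable X]setTI.
by apply: (measurable_coord_rV i) => //; exact: mA.
Qed.

(** Balls of the sup norm are products of intervals, which is what makes their
    Lebesgue measure computable. *)
Definition cube n (a : 'rV[R]_n) (r : R) : set 'rV[R]_n :=
  [set x | `|x - a| <= r].

Lemma cubeE n (a : 'rV[R]_n) r : 0 <= r ->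
  cube a r = [set x | forall i, `[a ord0 i - r, a ord0 i + r]%classic (x ord0 i)].
Proof.
move=> r0; apply/seteqP; split=> x /=.
  move=> /(ler_rV_norm _ r0) xr i; have := xr i.
  by rewrite !mxE ler_distl in_itv.
move=> xr; apply/(ler_rV_norm _ r0) => i; have := xr i.
by rewrite !mxE ler_distl in_itv.
Qed.

Lemma measurable_cube n (a : 'rV[R]_n) r : 0 <= r -> measurable (cube a r).
Proof.
move=> r0; rewrite cubeE//.
apply: (@measurable_coord_preimage _
  (fun i => `[a ord0 i - r, a ord0 i + r]%classic)).
by move=> i; exact: measurable_itv.
Qed.

Lemma lebesgue_rV_cube n (a : 'rV[R]_n) r : 0 <= r ->
  lebesgue_rV n (cube a r) = ((2 * r) ^+ n)%:E.
Proof.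
move=> r0; rewrite cubeE//.
rewrite (@lebesgue_rV_box _ _ (fun i => `[a ord0 i - r, a ord0 i + r]%classic)).
  2: by move=> i; exact: measurable_itv.
under eq_bigr do rewrite lebesgue_measure_itv/= lte_fin.
have -> : ((2 * r) ^+ n)%:E = (\prod_(i < n) (2 * r)%:E)%E.
  by rewrite prodEFin prodr_const card_ord.
apply: eq_bigr => i _; case: ltP => h.
  by rewrite -EFinB; congr EFin; lra.
by congr EFin; lra.
Qed.

(** The sigma-algebra is the one generated by the coordinates; it contains the
    open sets because these are countable unions of boxes with rational centre
    and radius. *)
Lemma open_measurable_rV n (U : set 'rV[R]_n) : open U -> measurable U.
Proof.
move=> oU.
pose B (p : 'rV[rat]_n * rat) : set 'rV[R]_n :=
  [set x | forall i, `](ratr (p.1 ord0 i) - ratr p.2), (ratr (p.1 ord0 i) + ratr p.2)[%classic (x ord0 i)].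
pose F p := if asbool (B p `<=` U) then B p else set0.
have -> : U = \bigcup_p F p.
  apply/seteqP; split => [x Ux|x [p _]]; last first.
    by rewrite /F; case: asboolP => // h; exact: h.
  move: oU; rewrite openE => /(_ _ Ux) /nbhs_ballP[e /= e0 eU].
  have e40 : 0 < e / 4 by rewrite divr_gt0.
  have rat_between (u v : R) : u < v -> exists q : rat, u < ratr q < v.
    by move=> /rat_in_itvoo[q]; rewrite in_itv /=; exists q.
  have [r /andP[er re]] : exists r : rat, e / 4 < ratr r < e / 2.
    by apply: rat_between; lra.
  have hq i : exists q : rat, x ord0 i - e / 4 < ratr q < x ord0 i + e / 4.
    by apply: rat_between; lra.
  pose q := \row_i (xchoose (hq i)).
  exists (q, r) => //; rewrite /F.
  have qx i : `|x ord0 i - ratr (q ord0 i)| < e / 4.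
    rewrite mxE distrC; have := xchooseP (hq i).
    by rewrite -ltr_distl.
  case: asboolP => [_ i|]; last first.
    case=> y yB; apply: eU; rewrite -ball_normE /=.
    apply/ltr_rV_norm => // i; rewrite !mxE.
    have := yB i; rewrite /= in_itv /= -ltr_distl => yq.
    have := qx i; have := ler_distD (ratr (q ord0 i)) (x ord0 i) (y ord0 i).
    rewrite (distrC (ratr (q ord0 i)) (y ord0 i)).
    move: yq re; rewrite /=; move: `|_| `|_| `|_| => u v w; lra.
  rewrite /= in_itv /= -ltr_distl; exact: lt_trans (qx i) er.
apply: countable_bigcupT_measurable; first exact: countableP.
move=> p; rewrite /F; case: asboolP => // _.
apply: (@measurable_coord_preimage _ (fun i => `](ratr (p.1 ord0 i) - ratr p.2),
  (ratr (p.1 ord0 i) + ratr p.2)[%classic)) => i.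
exact: measurable_itv.
Qed.

Lemma continuous_measurable_rV n (f : 'rV[R]_n -> R) :
  continuous f -> measurable_fun setT f.
Proof.
move=> /continuousP cf; apply: (measurability _ (RGenOpens.measurableE R)).
move=> _ [_ [a [b ->] <-]]; rewrite setTI; apply: open_measurable_rV.
exact/cf/interval_open.
Qed.

Lemma closed_singleton_rV n (a : 'rV[R]_n) : closed [set a].
Proof.
exact: (accessible_closed_set1 (hausdorff_accessible (@norm_hausdorff R 'rV[R]_n))).
Qed.

(** The potentials are continuous except at their pole, where they take a
    junk value. *)
Lemma continuous_punctured_measurable n (f : 'rV[R]_n -> R) a :
  (forall x, x != a -> {for x, continuous f}) -> measurable_fun setT f.
Proof.
move=> cf.
have oC : open (~` [set a]) by exact/closed_openC/closed_singleton_rV.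
rewrite -(setvU [set a]) setUC; apply/measurable_funU.
- by rewrite -[X in measurable X]setCK; apply: measurableC; exact: open_measurable_rV.
- exact: open_measurable_rV.
split; first exact: measurable_fun_set1.
apply: (measurability _ (RGenOpens.measurableE R)).
move=> _ [_ [c [d ->] <-]]; apply: open_measurable_rV.
rewrite openE => x [/= xa fx].
have xa' : x != a by apply/eqP.
apply: filterI; first exact: open_nbhs_nbhs.
apply: (cf _ xa' (`]c, d[%classic)).
by apply: open_nbhs_nbhs; split => //; exact: interval_open.
Qed.

Definition bounded_support n (f : 'rV[R]_n -> R) :=
  exists M : R, forall x, M < `|x| -> f x = 0.

Lemma bounded_support_pos n (f : 'rV[R]_n -> R) : bounded_support f ->
  exists2 M : R, 0 < M & forall x, M <= `|x| -> f x = 0.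
Proof.
move=> [M h]; exists (`|M| + 1); first by rewrite ltr_wpDl.
by move=> x xM; apply: h; apply: lt_le_trans xM; rewrite ltr_pwDr// ler_norm.
Qed.

Lemma bounded_support_bounded n (f : 'rV[R]_n -> R) :
  continuous f -> bounded_support f -> exists2 C : R, 0 < C & forall x, `|f x| <= C.
Proof.
move=> cf /bounded_support_pos [M M0 fM].
have cK : compact (cube (0 : 'rV[R]_n) M).
  apply: bounded_closed_compact.
    exists M; split=> [|t Mt x]; first exact: num_real.
    by rewrite /cube /= subr0 => /le_trans; apply; exact: ltW.
  have -> : cube (0 : 'rV[R]_n) M = (fun x : 'rV[R]_n => `|x|) @^-1` [set y | y <= M].
    by apply/seteqP; split => x /=; rewrite /cube /= subr0.
  by apply: preimage_closed; [move=> ? _; exact: norm_continuous|exact: closed_le].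
have /compact_bounded : compact (f @` cube 0 M).
  by apply: continuous_compact => //; exact: continuous_subspaceT.
move=> [C [_ hC]]; exists (`|C| + 1); first by rewrite ltr_wpDl.
move=> x; have [xM|Mx] := leP `|x| M.
  apply: hC; first by rewrite ltr_pwDr// ler_norm.
  by exists x => //; rewrite /cube /= subr0.
by rewrite fM ?normr0 ?addr_ge0// ltW.
Qed.

End rV_measure.

(** * Fubini for Lebesgue measure on row vectors *)

Section sigma_finite_pack.
Context d (T : measurableType d) (R : realType) (m : {measure set T -> \bar R}).
Hypothesis mfin : sigma_finite setT m.

(** Fubini's theorems apply to measures bundled with their sigma-finiteness,
    whereas lebesgue_rV is bundled as a measure only. *)
Definition with_sigma_finite : {sigma_finite_measure set T -> \bar R} :=
  HB.pack_for (sigma_finite_measure T R) (Measure.sort m)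
    (Measure.class m)
    (@isSFinite.Build _ _ _ (Measure.sort m) (sfinite_measure_sigma_finite mfin))
    (@isSigmaFinite.Build _ _ _ (Measure.sort m) mfin).

Lemma with_sigma_finiteE : with_sigma_finite = m :> {measure set T -> \bar R}.
Proof. by rewrite /with_sigma_finite; move: mfin; case: m => f [c1 c2] h. Qed.

End sigma_finite_pack.

Section rV_integral.
Context {R : realType}.

Lemma lebesgue_rV_sigma_finite n : sigma_finite setT (@lebesgue_rV R n).
Proof.
exists (fun k => cube 0 k%:R).
  apply/esym/seteqP; split=> // x _.
  exists (Num.truncn `|x|).+1 => //; rewrite /cube /= subr0.
  exact/ltW/truncnS_gt.
by move=> k; split; [exact: measurable_cube|rewrite lebesgue_rV_cube// ltry].
Qed.

Lemma bounded_support_integrable n (f : 'rV[R]_n -> R) :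
  continuous f -> bounded_support f ->
  (lebesgue_rV n).-integrable setT (EFin \o f).
Proof.
move=> cf bf; have [C C0 fC] := bounded_support_bounded cf bf.
have [M M0 fM] := bounded_support_pos bf.
have mC : measurable (cube (0 : 'rV[R]_n) M) by apply: measurable_cube; exact: ltW.
have mf := continuous_measurable_rV cf.
have : (lebesgue_rV n).-integrable (cube 0 M) (EFin \o f).
  apply: measurable_bounded_integrable => //.
  - by rewrite lebesgue_rV_cube ?ltry// ltW.
  - exact: measurable_funTS.
  - exists C; split=> [|t Ct x _]; first exact: num_real.
    by apply: le_trans (fC x) _; exact: ltW.
move=> /(integrable_mkcond _ mC); congr integrable.
apply/funext => x; rewrite patchE; case: ifPn => // /negP; rewrite inE /cube /= subr0.
by move=> /negP; rewrite -ltNge => /ltW /fM /= ->.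
Qed.

(** The measure in dimension n+1 is the image by rV_cons of a product measure, in
    which the last factor is the coordinate of index 0.  Both orders of
    integration are needed, according to the direction in which one
    differentiates. *)
Lemma lebesgue_rV_fubini n (f : 'rV[R]_n.+1 -> \bar R) :
  (lebesgue_rV n.+1).-integrable setT f ->
  (\int[lebesgue_rV n.+1]_x f x =
     \int[lebesgue_rV n]_x \int[lebesgue_measure]_t f (rV_cons (x, t)) /\
   \int[lebesgue_rV n.+1]_x f x =
     \int[lebesgue_measure]_t \int[lebesgue_rV n]_x f (rV_cons (x, t)))%E.
Proof.
move=> intf.
have [mf foo] := integrableP _ _ _ intf.
have mc := @measurable_rV_cons R n.
pose m := with_sigma_finite (lebesgue_rV_sigma_finite n).
have mE : m = lebesgue_rV n :> {measure set _ -> \bar R}.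
  exact: with_sigma_finiteE.
pose prod1 (m1 : {measure set 'rV[R]_n -> \bar R}) :=
  [the {measure set _ -> \bar R} of (m1 \x (@lebesgue_measure R))%E].
have int1 : (prod1 (lebesgue_rV n)).-integrable setT (f \o @rV_cons R n).
  apply/integrableP; split.
    move=> _ B mB; rewrite setTI comp_preimage -[X in measurable X]setTI.
    by apply: mc => //; rewrite -[X in measurable X]setTI; exact: mf.
  move: foo; rewrite [X in (X < _)%E -> _](_ : _ =
    \int[pushforward (prod1 (lebesgue_rV n)) (@rV_cons R n)]_x `|f x|)%E.
    rewrite ge0_integral_pushforward//. 
    exact: measurableT_comp.
  exact: eq_measure_integral.
have int2 : (prod1 m).-integrable setT (f \o @rV_cons R n) by rewrite mE.
have E : (\int[lebesgue_rV n.+1]_x f x = \int[prod1 m]_z (f \o @rV_cons R n) z)%E.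
  have -> : (\int[lebesgue_rV n.+1]_x f x =
     \int[pushforward (prod1 (lebesgue_rV n)) (@rV_cons R n)]_x f x)%E.
    exact: eq_measure_integral.
  by rewrite integral_pushforward// mE.
split.
  by rewrite E -mE -(integral12_prod_meas1 int2).
by rewrite E -mE -(integral21_prod_meas1 int2).
Qed.

End rV_integral.

(** * Integrals of partial derivatives *)

Section divergence.
Context {R : realType}.

Local Notation e i := (delta_mx ord0 i).

Lemma rV_cons_norml n (x : 'rV[R]_n) t : `|x| <= `|rV_cons (x, t)|.
Proof.
apply/ler_rV_norm => // i.
have := coord_le_norm (rV_cons (x, t)) (lift ord0 i).
by rewrite mxE liftK.
Qed.

Lemma rV_cons_normr n (x : 'rV[R]_n) t : `|t| <= `|rV_cons (x, t)|.
Proof. by have := coord_le_norm (rV_cons (x, t)) ord0; rewrite mxE unlift_none. Qed.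

Lemma rV_cons_addl n (x : 'rV[R]_n) t (i : 'I_n) (s : R) :
  rV_cons (s *: e i + x, t) = s *: e (lift ord0 i) + rV_cons (x, t).
Proof.
apply/rowP => j; rewrite !mxE; case: unliftP => [k ->|->] /=.
  by rewrite !mxE (inj_eq lift_inj).
by rewrite mulr0 add0r.
Qed.

Lemma rV_cons_addr n (x : 'rV[R]_n) t (s : R) :
  rV_cons (x, s *: (1 : R) + t) = s *: e ord0 + rV_cons (x, t).
Proof.
apply/rowP => j; rewrite !mxE; case: unliftP => [k ->|->] //=.
by rewrite mulr0 add0r.
Qed.

Lemma near_norm_lt n (x : 'rV[R]_n) eps : 0 < eps ->
  \forall y \near x, `|x - y| < eps.
Proof.
by move=> e0; apply/nbhs_ballP; exists eps => // y; rewrite -ball_normE.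
Qed.

Lemma rV_cons_continuousl n (t : R) : continuous (fun x : 'rV[R]_n => rV_cons (x, t)).
Proof.
move=> x; apply/(@cvgrPdist_lt _ 'rV[R]_n.+1 _ (nbhs x) _) => eps e0.
apply: filterS (near_norm_lt x e0) => y xy.
apply/ltr_rV_norm => // j; rewrite !mxE; case: unliftP => [k _|_] /=.
  have -> : x ord0 k - y ord0 k = (x - y) ord0 k by rewrite !mxE.
  exact: le_lt_trans (coord_le_norm _ _) _.
by rewrite subrr normr0.
Qed.

Lemma rV_cons_continuousr n (x : 'rV[R]_n) : continuous (fun t : R => rV_cons (x, t)).
Proof.
move=> t; apply/(@cvgrPdist_lt _ 'rV[R]_n.+1 _ (nbhs t) _) => eps e0.
have : \forall y \near t, `|t - y| < eps by exact: (@cvgr_dist_lt _ R _ (nbhs t) _ id).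
apply: filterS => y ty.
apply/ltr_rV_norm => // j; rewrite !mxE; case: unliftP => [k _|_] //=.
by rewrite subrr normr0.
Qed.

Lemma near_partial n (i : 'I_n) (f g : 'rV[R]_n -> R) (x : 'rV[R]_n) :
  (\forall y \near x, f y = g y) -> \forall y \near x, partial i f y = partial i g y.
Proof.
move=> /nbhs_interior; apply: filterS => y; exact: near_eq_derive.
Qed.

Lemma partial_near0 n (i : 'I_n) (f : 'rV[R]_n -> R) (x : 'rV[R]_n) :
  (\forall y \near x, f y = 0) -> \forall y \near x, partial i f y = 0.
Proof.
move=> /(@near_partial n i f (cst 0)); apply: filterS => y ->.
by rewrite /partial derive_cst.
Qed.

Lemma partial_bounded_support n (i : 'I_n) (f : 'rV[R]_n -> R) :
  bounded_support f -> bounded_support (partial i f).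
Proof.
move=> [M fM]; exists M => x Mx.
have : \forall y \near x, f y = 0.
  have nx : \forall y \near x, M < `|y|.
    apply: (@cvgr_gt _ _ (nbhs x) _ (fun y : 'rV[R]_n => `|y|) `|x|) => //.
    exact: norm_continuous.
  by apply: filterS nx => y; exact: fM.
by move=> /(@partial_near0 n i) /nbhs_singleton.
Qed.

(** The fundamental theorem of calculus on an interval outside of which F is 0. *)
Lemma integral_derive1_bounded_support (F : R -> R) :
  (exists2 M : R, 0 < M & forall t, M <= `|t| -> F t = 0) ->
  (forall t, derivable F t 1) -> continuous (F^`()%classic) ->
  (\int[lebesgue_measure]_t ((F^`())%classic t)%:E = 0)%E.
Proof.
move=> [M M0 FM] dF cF.
have dF0 t : M < `|t| -> (F^`())%classic t = 0.
  move=> Mt; rewrite derive1E -[RHS](derive_cst (0 : R) t (1 : R)).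
  apply: near_eq_derive; near=> y; apply: FM; apply: ltW; near: y.
  exact: (cvgr_gt `|t| (@norm_continuous _ _ t)).
have FE : (\int[lebesgue_measure]_t ((F^`())%classic t)%:E =
  \int[lebesgue_measure]_(t in `[(- (M + 1))%R, (M + 1)%R]) ((F^`())%classic t)%:E)%E.
  rewrite [RHS]integral_mkcond; apply: eq_integral => t _; rewrite patchE.
  case: ifPn => // /negP; rewrite inE /= in_itv /= -ler_norml => /negP.
  rewrite -ltNge => Mt; rewrite dF0//; apply: lt_trans Mt; rewrite ltrDl; exact: ltr01.
have cFF t : {for t, continuous F}.
  by apply/differentiable_continuous/derivable1_diffP.
rewrite FE (@continuous_FTC2 _ _ F).
- by rewrite !FM ?subee// ?normrN ger0_norm ?lerDl// addr_ge0// ltW.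
- lra.
- exact: continuous_subspaceT.
- split=> [t _||]; first exact: dF.
  + by apply: cvg_at_right_filter; exact: cFF.
  + by apply: cvg_at_left_filter; exact: cFF.
- by [].
Unshelve. all: by end_near. Qed.

(** Integrate first in the coordinate j of differentiation: if j is the
    coordinate split off by rV_cons, the inner integral is one-dimensional;
    otherwise the slices with that coordinate fixed fall under the induction
    hypothesis. *)
Lemma integral_partial_eq0 n (j : 'I_n) (G : 'rV[R]_n -> R) :
  bounded_support G -> (forall x, derivable G x (e j)) -> continuous (partial j G) ->
  (\int[lebesgue_rV n]_x (partial j G x)%:E = 0)%E.
Proof.
elim: n j G => [[]//|n IH] j G bG dG cG.
have intG : (lebesgue_rV n.+1).-integrable setT (EFin \o partial j G).
  by apply: bounded_support_integrable => //; exact: partial_bounded_support.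
have [M M0 GM] := bounded_support_pos bG.
have [F1 F2] := lebesgue_rV_fubini intG.
have [i jE|jE] := unliftP ord0 j; subst j.
  rewrite F2 integral0_eq// => t _.
  pose H x := G (rV_cons (x, t)).
  have HE x : (fun h : R => h^-1 *: ((H \o shift x) (h *: (e i : 'rV[R]_n)) - H x)) =
     (fun h : R => h^-1 *: ((G \o shift (rV_cons (x, t))) (h *: (e (lift ord0 i) : 'rV[R]_n.+1)) - G (rV_cons (x, t)))).
    by apply/funext => s /=; rewrite /H rV_cons_addl.
  have pH x : partial i H x = partial (lift ord0 i) G (rV_cons (x, t)).
    by rewrite /partial /derive HE.
  rewrite -(IH i H).
  - by apply: eq_integral => x _; rewrite pH.
  - exists M => x Mx; apply: GM; apply: le_trans (rV_cons_norml _ _); exact: ltW.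
  - by move=> x; rewrite /derivable HE; exact: dG.
  - rewrite (_ : partial i H = partial (lift ord0 i) G \o (fun x => rV_cons (x, t))).
      by move=> x; apply: continuous_comp; [exact: rV_cons_continuousl|exact: cG].
    by apply/funext => x; exact: pH.
rewrite F1 integral0_eq// => x _.
pose H t := G (rV_cons (x, t)).
have HE t : (fun h : R => h^-1 *: ((H \o shift t) (h *: (1 : R)) - H t)) =
   (fun h : R => h^-1 *: ((G \o shift (rV_cons (x, t))) (h *: (e ord0 : 'rV[R]_n.+1)) - G (rV_cons (x, t)))).
  by apply/funext => s /=; rewrite /H rV_cons_addr.
have pH : H^`()%classic = partial ord0 G \o (fun t => rV_cons (x, t)).
  by apply/funext => t /=; rewrite derive1E /partial /derive HE.
have cH : continuous (H^`()%classic).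
  rewrite pH => t; apply: continuous_comp; [exact: rV_cons_continuousr|exact: cG].
rewrite -(@integral_derive1_bounded_support H) ?pH//.
- exists M => // t Mt; apply: GM; apply: le_trans (rV_cons_normr _ _); exact: Mt.
- by move=> t; rewrite /derivable HE; exact: dG.
- by rewrite -pH.
Qed.

End divergence.

(** * Calculus of one directional derivative *)

Section directional_C1.
Context {R : realType} {N : nat}.
Implicit Types (A S : set 'rV[R]_N) (f g : 'rV[R]_N -> R) (j : 'I_N).

Local Notation e i := (delta_mx ord0 i : 'rV[R]_N).

(** Carrying the derivative explicitly, rather than as partial j f, makes the
    class stable under the operations below on any set A, open or not. *)
Definition C1dir A j f df := forall x, A x ->
  [/\ {for x, continuous f}, is_derive x (e j) f (df x) & {for x, continuous df}].

Lemma C1dir_partial A j f df x : C1dir A j f df -> A x -> partial j f x = df x.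
Proof. by move=> /[apply] -[_ fd _]; rewrite /partial derive_val. Qed.

Lemma C1dir_cst A j c : C1dir A j (fun=> c) (fun=> 0).
Proof. by move=> x _; split; [exact: cst_continuous|exact: is_derive_cst|exact: cst_continuous]. Qed.

Lemma C1dirD A j f g df dg : C1dir A j f df -> C1dir A j g dg ->
  C1dir A j (fun x => f x + g x) (fun x => df x + dg x).
Proof.
move=> hf hg x Ax; have [f1 f2 f3] := hf x Ax; have [g1 g2 g3] := hg x Ax.
by split; [exact: continuousD|exact: is_deriveD|exact: continuousD].
Qed.

Lemma C1dirN A j f df : C1dir A j f df ->
  C1dir A j (fun x => - f x) (fun x => - df x).
Proof.
move=> hf x Ax; have [f1 f2 f3] := hf x Ax.
by split; [exact: continuousN|exact: is_deriveN|exact: continuousN].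
Qed.

Lemma C1dir_sum A j n (f df : 'I_n -> 'rV[R]_N -> R) :
  (forall i, C1dir A j (f i) (df i)) ->
  C1dir A j (fun x => \sum_i f i x) (fun x => \sum_i df i x).
Proof.
elim: n f df => [|n IH] f df h.
  have E (F : 'I_0 -> 'rV[R]_N -> R) : (fun x => \sum_i F i x) = fun=> 0.
    by apply/funext => x; rewrite big_ord0.
  by rewrite !E; exact: C1dir_cst.
have E (F : 'I_n.+1 -> 'rV[R]_N -> R) : (fun x => \sum_i F i x) =
    fun x => F ord0 x + \sum_i F (lift ord0 i) x.
  by apply/funext => x; rewrite big_ord_recl.
by rewrite !E; apply: C1dirD => //; exact: IH.
Qed.

Lemma C1dirM A j f g df dg : C1dir A j f df -> C1dir A j g dg ->
  C1dir A j (fun x => f x * g x) (fun x => f x * dg x + g x * df x).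
Proof.
move=> hf hg x Ax; have [f1 f2 f3] := hf x Ax; have [g1 g2 g3] := hg x Ax.
split; [exact: continuousM|exact: is_deriveM|].
by apply: continuousD; exact: continuousM.
Qed.

Lemma C1dirV A j f df : C1dir A j f df -> (forall x, A x -> f x != 0) ->
  C1dir A j (fun x => (f x)^-1) (fun x => - (f x ^+ 2)^-1 * df x).
Proof.
move=> hf f0 x Ax; have [f1 f2 f3] := hf x Ax; have fx0 := f0 x Ax.
split; first exact: continuousV.
  apply: DeriveDef; first exact: derivableV.
  by rewrite deriveV// derive_val.
apply: continuousM => //; apply: continuousN; apply: continuousV.
  by rewrite sqrf_eq0.
by apply: continuousM.
Qed.

Lemma C1dir_coord A i j : C1dir A j (fun x => x ord0 i) (fun=> (i == j)%:R).
Proof.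
move=> x _; split; [exact: coord_continuous| |exact: cst_continuous].
have E : (fun h : R => h^-1 *: (((fun y : 'rV[R]_N => y ord0 i) \o shift x) (h *: e j) - x ord0 i))
   = (fun h => h^-1 * h * (i == j)%:R).
  by apply/funext => h /=; rewrite !mxE addrK eqxx /= [_ *: _]mulrA.
have C : (fun h : R => h^-1 * h * (i == j)%:R) @ 0^' --> ((i == j)%:R : R).
  apply: cvg_near_cst.
  near=> h; rewrite mulVf ?mul1r//; near: h; exact: nbhs_dnbhs_neq.
apply: DeriveDef; first by rewrite /derivable E; apply/cvg_ex; exists (i == j)%:R.
by rewrite /derive E; exact: cvg_lim C.
Unshelve. all: by end_near. Qed.

(** The derivative of f along e_j is that of f on the line through x, where the
    one-dimensional chain rule applies. *)
Lemma C1dir_comp A j f df (s ds : R -> R) : C1dir A j f df ->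
  (forall t : R, is_derive t (1 : R) s (ds t)) -> continuous ds ->
  C1dir A j (s \o f) (fun x => ds (f x) * df x).
Proof.
move=> hf hs cs x Ax; have [f1 f2 f3] := hf x Ax.
have cvs t : {for t, continuous s}.
  by apply/differentiable_continuous/derivable1_diffP; have [] := hs t.
split; first by apply: continuous_comp.
  (* the quotients of g along e_j are those of its restriction to the line *)
  pose l (h : R) : R := f (h *: e j + x).
  have E (g : 'rV[R]_N -> R) : (fun h : R => h^-1 *: ((g \o shift x) (h *: e j) - g x)) =
    (fun h : R => h^-1 *: (((fun h : R => g (h *: e j + x)) \o shift 0) (h *: (1 : R)) - g (0 *: e j + x))).
    by apply/funext => h /=; rewrite scale0r add0r addr0 [h *: 1]mulr1.
  have dl : derivable l 0 1.
    by case: f2 => + _; rewrite /derivable E.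
  have dl' : 'D_1 l 0 = df x.
    by case: f2 => _ <-; rewrite /derive E.
  have l0 : l 0 = f x by rewrite /l scale0r add0r.
  have dsl : derivable s (l 0) 1 by have [] := hs (l 0).
  have D : derivable (s \o l) 0 1.
    by apply/derivable1_diffP/differentiable_comp; exact/derivable1_diffP.
  apply: DeriveDef; first by rewrite /derivable E.
  have := derive1_comp dl dsl; rewrite !derive1E dl' l0.
  have [_ ->] := hs (f x).
  by move=> <-; rewrite {1}/derive E.
by apply: continuousM => //; apply: continuous_comp => //; exact: cs.
Qed.

Lemma Ck1_C1dir A f j : Ck 1 A f -> C1dir A j f (partial j f).
Proof.
move=> [cf /(_ j) [df cdf]] x Ax; split; [exact: cf| |exact: cdf].
exact/derivableP/df.
Qed.

Definition vanishes_near S f := forall x, S x -> \forall y \near x, f y = 0.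

(** This is how psi^2 F becomes a C^1 field on the whole space although F is only
    defined off S. *)
Lemma C1dir_glue S j f df : C1dir (~` S) j f df ->
  vanishes_near S f -> vanishes_near S df -> C1dir setT j f df.
Proof.
move=> h f0 df0 x _; have [Sx|] := pselect (S x); last exact: h.
have E g : (\forall y \near x, g y = 0) -> {for x, continuous g}.
  move=> gx; have g0 : g x = 0 := nbhs_singleton gx.
  by rewrite /prop_for /continuous_at g0; exact: (@cvg_near_cst _ _ 0 g (nbhs x)).
split; [exact/E/f0| |exact/E/df0].
have -> : df x = 0 := nbhs_singleton (df0 _ Sx).
apply: (@near_eq_is_derive _ _ _ (cst (0 : R))).
  by apply: filterS (f0 _ Sx) => y ->.
Qed.

End directional_C1.

(** * The divergence form bound *)

Section real_integrable.
Context d (T : measurableType d) (R : realType) (mu : {measure set T -> \bar R}).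
Implicit Types f g : T -> R.

Local Notation intg f := (mu.-integrable setT (EFin \o f)).

Lemma intgD f g : intg f -> intg g -> intg (fun x => f x + g x).
Proof. by move=> hf hg; exact (integrableD measurableT hf hg). Qed.

Lemma intgZ c f : intg f -> intg (fun x => c * f x).
Proof. by move=> hf; exact (integrableZl measurableT c hf). Qed.

Lemma intgB f g : intg f -> intg g -> intg (fun x => f x - g x).
Proof. by move=> hf hg; exact (integrableB measurableT hf hg). Qed.

Lemma intg_sum n (f : 'I_n -> T -> R) :
  (forall i, intg (f i)) -> intg (fun x => \sum_i f i x).
Proof.
move=> h; have : mu.-integrable setT (fun x => \sum_(i < n) (f i x)%:E)%E.
  by apply: integrable_sum => // i _; exact: h.
by congr integrable; apply/funext => x /=; rewrite sumEFin.
Qed.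

Lemma Rintegral_sum n (f : 'I_n -> T -> R) : (forall i, intg (f i)) ->
  (\int[mu]_x \sum_i f i x) = \sum_i \int[mu]_x f i x.
Proof.
elim: n f => [|n IH] f h.
  rewrite big_ord0; under eq_Rintegral do rewrite big_ord0.
  by rewrite /Rintegral integral0.
rewrite big_ord_recl -IH//; under eq_Rintegral do rewrite big_ord_recl.
by rewrite RintegralD//; exact: intg_sum.
Qed.

Lemma intg_le f g : measurable_fun setT f -> intg g ->
  (forall x, `|f x| <= g x) -> intg f.
Proof.
move=> mf ig fg; apply: le_integrable ig => //; first exact/measurable_EFinP.
move=> x _ /=; rewrite lee_fin; apply: le_trans (fg x) _; exact: ler_norm.
Qed.

Lemma intg_ge0P f c : measurable_fun setT f -> (forall x, 0 <= f x) ->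
  (\int[mu]_x (f x)%:E <= c%:E)%E -> intg f /\ \int[mu]_x f x <= c.
Proof.
move=> mf f0 fc; have fo : (\int[mu]_x (f x)%:E < +oo)%E.
  by apply: le_lt_trans fc _; exact: ltry.
have if_ : intg f.
  apply/integrableP; split; first exact/measurable_EFinP.
  by under eq_integral => x _ do rewrite /= ger0_norm//.
split=> //; rewrite -lee_fin /Rintegral fineK//.
exact: integrable_fin_num.
Qed.

Lemma intg_ge0_fin f : intg f -> (forall x, 0 <= f x) ->
  (\int[mu]_x (f x)%:E = (\int[mu]_x f x)%:E)%E.
Proof. by move=> hf f0; rewrite /Rintegral fineK//; exact: integrable_fin_num. Qed.

End real_integrable.

Section green.
Context {R : realType} {N : nat}.
Implicit Types (S : set 'rV[R]_N) (psi W : 'rV[R]_N -> R).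

Local Notation mu := (@lebesgue_rV R N).
Local Notation intg f := (mu.-integrable setT (EFin \o f)).

Lemma enorm_sqr (x : 'rV[R]_N) : enorm x ^+ 2 = \sum_i x ord0 i ^+ 2.
Proof. by rewrite sqr_sqrtr// sumr_ge0// => i _; rewrite sqr_ge0. Qed.

Lemma enorm_grad_sqr f (x : 'rV[R]_N) : enorm (grad f x) ^+ 2 = \sum_i partial i f x ^+ 2.
Proof. by rewrite enorm_sqr; apply: eq_bigr => i _; rewrite mxE. Qed.

(** The test functions for the supersolution argument: S is the set of poles. *)
Definition admissible S psi :=
  [/\ Ck 1 setT psi, bounded_support psi & vanishes_near S psi].

Lemma bounded_supportM f g : bounded_support f ->
  bounded_support (fun x : 'rV[R]_N => f x * g x).
Proof. by move=> [M h]; exists M => x /h ->; rewrite mul0r. Qed.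

Lemma continuous_sum n (f : 'I_n -> 'rV[R]_N -> R) x :
  (forall i, {for x, continuous (f i)}) ->
  {for x, continuous (fun x => \sum_i f i x)}.
Proof.
elim: n f => [|n IH] f h.
  rewrite (_ : (fun x => _) = fun=> 0); first exact: cst_continuous.
  by apply/funext => y; rewrite big_ord0.
rewrite (_ : (fun x => _) = fun x => f ord0 x + \sum_i f (lift ord0 i) x).
  by apply: continuousD; [exact: h|exact: IH].
by apply/funext => y; rewrite big_ord_recl.
Qed.

Lemma admissible_intg S psi W : admissible S psi ->
  (forall x, (~` S) x -> {for x, continuous W}) -> intg (fun x => W x * psi x ^+ 2).
Proof.
move=> [[cpsi _] bpsi vpsi] cW; apply: bounded_support_integrable; last first.
  by have [M h] := bpsi; exists M => x /h ->; rewrite expr0n mulr0.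
move=> x; have [Sx|nSx] := pselect (S x).
  have px : psi x = 0 := nbhs_singleton (vpsi _ Sx).
  rewrite /prop_for /continuous_at px expr0n mulr0.
  apply: (@cvg_near_cst _ _ 0 _ (nbhs x)).
  by apply: filterS (vpsi _ Sx) => y ->; rewrite expr0n mulr0.
have cpx := cpsi x I.
exact (continuousM (cW x nSx) (continuousM cpx cpx)).
Qed.

Lemma partial_sqr_intg S psi i : admissible S psi -> intg (fun x => partial i psi x ^+ 2).
Proof.
move=> [[_ /(_ i) [_ cp]] bpsi _].
apply: bounded_support_integrable.
  by move=> x; exact (continuousM (cp x I) (cp x I)).
by apply: bounded_supportM; exact: partial_bounded_support.
Qed.

Lemma grad_sqr_intg S psi : admissible S psi -> intg (fun x => enorm (grad psi x) ^+ 2).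
Proof.
move=> apsi; rewrite (_ : (fun x => _) = fun x => \sum_i partial i psi x ^+ 2).
  by apply: intg_sum => i; exact: partial_sqr_intg apsi.
by apply/funext => x; rewrite enorm_grad_sqr.
Qed.

(** Integrate |grad psi + psi F|^2 >= 0 after writing its cross term as
    div (psi^2 F) - psi^2 div F. *)
Lemma divergence_form_bound S psi W (F dF : 'I_N -> 'rV[R]_N -> R) :
  admissible S psi ->
  (forall j, C1dir (~` S) j (F j) (dF j)) ->
  (forall x, (~` S) x -> {for x, continuous W}) ->
  (forall x, (~` S) x -> W x <= \sum_j (dF j x - F j x ^+ 2)) ->
  \int[mu]_x (W x * psi x ^+ 2) <= \int[mu]_x (enorm (grad psi x) ^+ 2).
Proof.
move=> apsi hF cW WF; have [C1psi bpsi vpsi] := apsi.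
pose G j x := psi x * psi x * F j x.
pose dG j x := psi x * psi x * dF j x
   + F j x * (psi x * partial j psi x + psi x * partial j psi x).
have hG j : C1dir setT j (G j) (dG j).
  apply: (@C1dir_glue _ _ S).
  - apply: C1dirM => //; apply: C1dirM => x _; exact: Ck1_C1dir C1psi _ _.
  - by move=> x /vpsi; apply: filterS => y; rewrite /G => ->; rewrite !mul0r.
  - by move=> x /vpsi; apply: filterS => y; rewrite /dG => ->; rewrite !mul0r addr0 mulr0 addr0.
have pG j : partial j (G j) = dG j.
  by apply/funext => x; exact: (C1dir_partial (hG j)).
have bG j : bounded_support (G j).
  by do 2 apply: bounded_supportM.
have cdG j : continuous (dG j) by move=> x; have [] := hG j x I.
have idG j : intg (dG j).
  by apply: bounded_support_integrable => //; rewrite -pG; exact: partial_bounded_support.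
have dG0 j : \int[mu]_x dG j x = 0.
  rewrite /Rintegral -pG integral_partial_eq0 ?pG//.
  by move=> x; have [_ [+ _] _] := hG j x I.
have iW := admissible_intg apsi cW.
have ig := grad_sqr_intg apsi.
have isum := intg_sum idG.
have sdG0 : \int[mu]_x (\sum_j dG j x) = 0.
  by rewrite Rintegral_sum//; apply: big1 => j _.
rewrite -[leRHS]addr0 -sdG0 -RintegralD//.
apply: le_Rintegral => //; first exact: intgD.
move=> x _; rewrite enorm_grad_sqr -big_split /=.
have [Sx|nSx] := pselect (S x).
  have px : psi x = 0 := nbhs_singleton (vpsi _ Sx).
  rewrite px expr0n mulr0; apply: sumr_ge0 => j _.
  by rewrite /dG px !mul0r addr0 mulr0 !addr0 sqr_ge0.
apply: le_trans (ler_wpM2r (sqr_ge0 (psi x)) (WF _ nSx)) _.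
rewrite mulr_suml; apply: ler_sum => j _; rewrite /dG -subr_ge0.
rewrite (_ : _ - _ = (partial j psi x + F j x * psi x) ^+ 2); first exact: sqr_ge0.
ring.
Qed.

End green.

(** * Hardy weight and angular potentials *)

Section hardy.
Context {R : realType} {N : nat}.
Implicit Types (S : set 'rV[R]_N) (a x : 'rV[R]_N).

Local Notation mu := (@lebesgue_rV R N).
Local Notation intg f := (mu.-integrable setT (EFin \o f)).

Lemma enorm_ge0 x : 0 <= enorm x.
Proof. exact: sqrtr_ge0. Qed.

Lemma enorm_gt0 x : x != 0 -> 0 < enorm x.
Proof.
move=> x0; rewrite lt_neqAle enorm_ge0 andbT eq_sym; apply: contra x0 => /eqP ex.
have : \sum_i x ord0 i ^+ 2 == 0 by rewrite -enorm_sqr ex expr0n.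
rewrite psumr_eq0 => [|i _]; last exact: sqr_ge0.
move=> /allP h; apply/eqP/rowP => i; rewrite mxE; apply/eqP.
by rewrite -sqrf_eq0; apply: h; rewrite mem_index_enum.
Qed.

Lemma coord_le_enorm x i : `|x ord0 i| <= enorm x.
Proof.
rewrite -sqrtr_sqr ler_wsqrtr// (bigD1 i)//= lerDl sumr_ge0// => j _.
exact: sqr_ge0.
Qed.

Lemma enormZ (c : R) x : 0 <= c -> enorm (c *: x) = c * enorm x.
Proof.
move=> c0; rewrite /enorm (_ : \sum_i _ = c ^+ 2 * \sum_i x ord0 i ^+ 2).
  by rewrite sqrtrM ?sqr_ge0// sqrtr_sqr ger0_norm.
by rewrite mulr_sumr; apply: eq_bigr => i _; rewrite mxE exprMn.
Qed.

Lemma enorm_continuous : continuous (@enorm R N).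
Proof.
move=> x; apply: (@continuous_comp _ _ _ (fun y : 'rV[R]_N => \sum_i y ord0 i ^+ 2) Num.sqrt).
  apply: continuous_sum => i.
  exact (continuousM (@coord_continuous _ _ _ ord0 i x) (@coord_continuous _ _ _ ord0 i x)).
exact: sqrt_continuous.
Qed.

Lemma subr_continuous a : continuous (fun x => x - a).
Proof.
by move=> x; apply: (@continuousB _ _ _ id (cst a)); [exact: cvg_id|exact: cst_continuous].
Qed.

Lemma enorm_sub_continuous a : continuous (fun x => enorm (x - a)).
Proof.
by move=> x; apply: (@continuous_comp _ _ _ (fun x => x - a) enorm);
  [exact: subr_continuous|exact: enorm_continuous].
Qed.

(** The value at a is 0, as it is for the angular potentials with pole a. *)
Definition hardy_weight a x : R := (enorm (x - a) ^+ 2)^-1.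

Lemma hardy_weight_ge0 a x : 0 <= hardy_weight a x.
Proof. by rewrite invr_ge0 sqr_ge0. Qed.

Lemma hardy_weight_continuous a x : x != a -> {for x, continuous (hardy_weight a)}.
Proof.
move=> xa; have e0 : enorm (x - a) != 0 by rewrite gt_eqF// enorm_gt0// subr_eq0.
have ce := @enorm_sub_continuous a x.
apply: (@continuousV _ _ (fun x => enorm (x - a) ^+ 2)).
  by rewrite sqrf_eq0.
exact (continuousM ce ce).
Qed.

Lemma C1dir_enorm_sqr A j a :
  C1dir A j (fun x => enorm (x - a) ^+ 2) (fun x => 2 * (x ord0 j - a ord0 j)).
Proof.
have -> : (fun x => enorm (x - a) ^+ 2) =
    fun x => \sum_i (x ord0 i - a ord0 i) * (x ord0 i - a ord0 i).
  apply/funext => x; rewrite enorm_sqr; apply: eq_bigr => i _.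
  by rewrite !mxE expr2.
have -> : (fun x : 'rV[R]_N => 2 * (x ord0 j - a ord0 j)) = fun x => \sum_i
   ((x ord0 i - a ord0 i) * ((i == j)%:R + 0) + (x ord0 i - a ord0 i) * ((i == j)%:R + 0)).
  apply/funext => x; rewrite (bigD1 j)//= eqxx mulr1n big1 => [|i /negbTE ->]; last by rewrite mulr0n; ring.
  ring.
apply: C1dir_sum => i.
by apply: C1dirM; (apply: C1dirD; [exact: C1dir_coord|exact: C1dir_cst]).
Qed.

(** The field is F = (x - a) / (2 |x - a|^2), for which
    div F - |F|^2 = ((N - 2) / 2 - 1 / 4) / |x - a|^2, and N >= 3 makes this at
    least 1 / (4 |x - a|^2). *)
Lemma hardy_admissible S a psi : (3 <= N)%N -> S a -> admissible S psi ->
  intg (fun x => hardy_weight a x * psi x ^+ 2) /\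
  \int[mu]_x (hardy_weight a x * psi x ^+ 2) <=
    4 * \int[mu]_x (enorm (grad psi x) ^+ 2).
Proof.
move=> N3 Sa apsi.
have ne x : (~` S) x -> x != a by move=> nSx; apply/eqP => xa; apply: nSx; rewrite xa.
have cw x : (~` S) x -> {for x, continuous (hardy_weight a)}.
  by move=> /ne; exact: hardy_weight_continuous.
have iw := admissible_intg apsi cw.
split => //.
pose rho x : R := enorm (x - a) ^+ 2.
pose F j x : R := 2^-1 * ((x ord0 j - a ord0 j) * (rho x)^-1).
pose dF j x : R := 2^-1 * ((x ord0 j - a ord0 j) *
  (- (rho x ^+ 2)^-1 * (2 * (x ord0 j - a ord0 j))) + (rho x)^-1 * ((j == j)%:R + 0)) +
  ((x ord0 j - a ord0 j) * (rho x)^-1) * 0.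
have rho0 x : (~` S) x -> rho x != 0.
  by move=> /ne xa; rewrite sqrf_eq0 gt_eqF// enorm_gt0// subr_eq0.
have hF j : C1dir (~` S) j (F j) (dF j).
  apply: C1dirM; first exact: C1dir_cst.
  apply: C1dirM.
    by apply: C1dirD; [exact: C1dir_coord|exact: C1dir_cst].
  by apply: C1dirV => //; exact: C1dir_enorm_sqr.
have := @divergence_form_bound _ _ S psi (fun x => 4^-1 * hardy_weight a x) F dF apsi hF.
rewrite (_ : \int[mu]_x _ = 4^-1 * \int[mu]_x (hardy_weight a x * psi x ^+ 2)); last first.
  rewrite -RintegralZl//; apply: eq_Rintegral => x _; ring.
rewrite ler_pdivrMl//; apply.
  by move=> x nSx; exact (continuousM (@cst_continuous 'rV[R]_N R (4^-1 : R) x) (cw x nSx)).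
move=> x nSx; have r0 := rho0 x nSx.
have r0' : 0 <= (rho x)^-1 by rewrite invr_ge0 sqr_ge0.
have -> : \sum_j (dF j x - F j x ^+ 2) =
    \sum_j (2^-1 * (rho x)^-1 - (5 / 4 * (rho x)^-1 ^+ 2) * (x - a) ord0 j ^+ 2).
  by apply: eq_bigr => j _; rewrite /dF /F eqxx mulr1n !mxE; field.
rewrite big_split /= sumrN sumr_const card_ord -mulr_sumr -enorm_sqr -/(rho x).
have -> : 5 / 4 * (rho x)^-1 ^+ 2 * rho x = 5 / 4 * (rho x)^-1 by field.
rewrite /hardy_weight -/(rho x) -mulr_natl.
have N3' : 3 <= N%:R :> R by rewrite (ler_nat _ 3).
have := ler_wpM2r r0' N3'; lra.
Qed.

End hardy.

Section angular.
Context {R : realType} {N : nat}.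
Implicit Types (h : 'rV[R]_N -> R) (a x : 'rV[R]_N).

Lemma C1_sphere_continuous h : C1_sphere h -> {within usphere, continuous h}.
Proof.
move=> hC; apply/subspace_continuousP => x xS.
have [U [H [oU Ux [cH _] HE]]] := hC x xS.
rewrite /from_subspace -(HE x Ux xS).
have : H y @[y --> within usphere (nbhs x)] --> H x.
  by apply: (cvg_trans _ (cH x Ux)); apply: cvg_app; exact: cvg_within.
apply: cvg_trans; apply: near_eq_cvg; apply: filterS (open_nbhs_nbhs (conj oU Ux)).
by move=> y Uy Sy; exact: HE.
Qed.

Lemma usphere_compact : compact (@usphere R N).
Proof.
apply: bounded_closed_compact.
  exists 1; split=> [|M M1 x /= x1]; first exact: num_real.
  apply: le_trans (ltW M1); apply/ler_rV_norm => // i.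
  by rewrite -x1; exact: coord_le_enorm.
rewrite (_ : usphere = enorm @^-1` [set 1])//.
apply: preimage_closed; first by move=> x _; exact: enorm_continuous.
exact: (accessible_closed_set1 (hausdorff_accessible (@norm_hausdorff R R))).
Qed.

Lemma C1_sphere_bounded h : C1_sphere h ->
  exists2 C : R, 0 < C & forall x, usphere x -> `|h x| <= C.
Proof.
move=> hC.
have /compact_bounded [C [_ hC']] : compact (h @` usphere).
  by apply: continuous_compact; [exact: C1_sphere_continuous|exact: usphere_compact].
exists (`|C| + 1); first by rewrite ltr_wpDl.
by move=> x xS; apply: hC'; [rewrite ltr_pwDr// ler_norm|exists x].
Qed.

Lemma normalized_usphere x : x != 0 -> usphere ((enorm x)^-1 *: x).
Proof.
move=> x0; rewrite /usphere /= enormZ ?invr_ge0 ?enorm_ge0// mulVf//.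
by rewrite gt_eqF// enorm_gt0.
Qed.

Lemma angular_potential_continuous h a x : C1_sphere h -> x != a ->
  {for x, continuous (angular_potential h a)}.
Proof.
move=> hC xa.
pose q (y : 'rV[R]_N) : 'rV[R]_N := (enorm (y - a))^-1 *: (y - a).
have e0 : enorm (x - a) != 0 by rewrite gt_eqF// enorm_gt0// subr_eq0.
have cq : {for x, continuous q}.
  have c1 := @continuousV _ _ (fun y : 'rV[R]_N => enorm (y - a)) x e0 (@enorm_sub_continuous _ _ a x).
  exact (cvgZ c1 (@subr_continuous _ _ a x)).
have qS y : y != a -> usphere (q y).
  by move=> ya; apply: normalized_usphere; rewrite subr_eq0.
have [U [H [oU Ux [cH _] HE]]] := hC (q x) (qS x xa).
have chq : {for x, continuous (h \o q)}.
  have chq' : {for x, continuous (H \o q)} by apply: continuous_comp => //; exact: cH.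
  rewrite /prop_for /continuous_at /= -(HE _ Ux (qS x xa)).
  apply: cvg_trans chq'.
  apply: (@near_eq_cvg _ _ (nbhs x) _ (H \o q) (h \o q)).
  have nU : \forall y \near x, U (q y).
    by apply: cq; exact: open_nbhs_nbhs.
  have na : \forall y \near x, y != a.
    apply: (open_nbhs_nbhs (A := [set y | y != a])); split => //.
    rewrite (_ : [set y | y != a] = ~` [set a]).
      exact/closed_openC/closed_singleton_rV.
    by apply/seteqP; split => y /eqP.
  by apply: filterS2 nU na => y Uy ya /=; rewrite HE//; exact: qS.
exact (continuousM chq (hardy_weight_continuous xa)).
Qed.

Lemma angular_potential_measurable h a : C1_sphere h ->
  measurable_fun setT (angular_potential h a).
Proof.
by move=> hC; apply: continuous_punctured_measurable => x; exact: angular_potential_continuous.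
Qed.

Lemma hardy_weight_measurable a : measurable_fun setT (hardy_weight a).
Proof.
by apply: continuous_punctured_measurable => x; exact: hardy_weight_continuous.
Qed.

Lemma angular_potential_bounded h : C1_sphere h ->
  exists2 C : R, 0 < C & forall a x, `|angular_potential h a x| <= C * hardy_weight a x.
Proof.
move=> /C1_sphere_bounded[C C0 hC]; exists C => // a x.
have [->|xa] := eqVneq x a.
  rewrite /angular_potential /hardy_weight (_ : enorm _ = 0).
    by rewrite expr0n /= invr0 !mulr0 normr0.
  by rewrite subrr -(scale0r 0) enormZ// mul0r.
rewrite /angular_potential normrM [`|_^-1|]ger0_norm ?hardy_weight_ge0//.
apply: ler_wpM2r; first exact: hardy_weight_ge0.
by apply: hC; apply: normalized_usphere; rewrite subr_eq0.
Qed.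

End angular.

Section supersolution.
Context {R : realType} {N k : nat}.
Variables (a : 'I_k -> 'rV[R]_N) (h : 'I_k -> 'rV[R]_N -> R).

Local Notation mu := (@lebesgue_rV R N).

(** The field is F = - grad v / v, for which div F - |F|^2 = - lap v / v; by the
    equation this exceeds the sum of the potentials by v^(2^* - 2). *)
Lemma Qform_admissible v psi : (forall i, C1_sphere (h i)) ->
  positive_classical_solution a h v -> admissible (range a) psi ->
  \sum_(i < k) \int[mu]_x (angular_potential (h i) (a i) x * psi x ^+ 2) <=
    \int[mu]_x (enorm (grad psi x) ^+ 2).
Proof.
move=> hC [C2v v_gt0 veq] apsi.
have ne i x : (~` range a) x -> x != a i.
  by move=> nSx; apply/eqP => xa; apply: nSx; exists i.
have cV i x : (~` range a) x -> {for x, continuous (angular_potential (h i) (a i))}.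
  by move=> /(ne i); exact: angular_potential_continuous.
have iV i := admissible_intg apsi (cV i).
rewrite -Rintegral_sum//; under eq_Rintegral do rewrite -mulr_suml.
pose dv j := partial j v.
pose F j x := - (dv j x * (v x)^-1).
pose dF j x := - (dv j x * (- (v x ^+ 2)^-1 * dv j x) + (v x)^-1 * partial j (dv j) x).
have v0 x : (~` range a) x -> v x != 0 by move=> /v_gt0 vx; rewrite gt_eqF.
have [cv dvC] := C2v.
apply: (@divergence_form_bound _ _ _ psi _ F dF apsi).
- move=> j; apply: C1dirN; apply: C1dirM.
    by have [_ +] := dvC j; exact: Ck1_C1dir.
  apply: C1dirV => // x Ax; have [dvj [cdvj _]] := dvC j; split.
  + exact: cv.
  + exact/derivableP/dvj.
  + exact: cdvj.
- move=> x nSx.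
  by apply: continuous_sum => i; exact: cV.
- move=> x nSx; have vx := v0 x nSx; have vx0 := v_gt0 x nSx.
  have -> : \sum_j (dF j x - F j x ^+ 2) = - laplacian v x / v x.
    rewrite /laplacian -sumrN mulr_suml; apply: eq_bigr => j _.
    by rewrite /dF /F /dv; field.
  rewrite ler_pdivlMr// mulr_suml -subr_ge0 veq//; exact: powR_ge0.
Qed.

End supersolution.

(** * Cutoff functions around the poles *)

Section cutoff.
Context {R : realType}.

(** The square of the positive part: a C^1 function, with derivative twice the
    positive part, from which all the cutoffs are made. *)
Definition sqrp (t : R) : R := Num.max 0 t ^+ 2.

(** A second-order Taylor bound uniform in the signs of t and u, so that the kink
    at 0 needs no separate treatment in the computation of the derivative. *)
Lemma sqrp_taylor (t u : R) :
  `|sqrp u - sqrp t - 2 * Num.max 0 t * (u - t)| <= (u - t) ^+ 2.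
Proof.
have u2 := sqr_ge0 u; have t2 := sqr_ge0 t; have ut2 := sqr_ge0 (u - t).
rewrite ler_norml /sqrp; case: (lerP 0 t) => t0; case: (lerP 0 u) => u0.
- by apply/andP; split; nra.
- have tu : t * u <= 0 by rewrite mulr_ge0_le0// ltW.
  by apply/andP; split; nra.
- have tu : t * u <= 0 by rewrite mulr_le0_ge0// ltW.
  by apply/andP; split; nra.
- by apply/andP; split; nra.
Qed.

Lemma is_derive_sqrp (t : R) : is_derive t (1 : R) sqrp (2 * Num.max 0 t).
Proof.
have C : (fun h : R => h^-1 *: ((sqrp \o shift t) (h *: (1 : R)) - sqrp t)) @ 0^' -->
    2 * Num.max 0 t.
  apply/(@cvgrPdist_le _ R) => e e0; near=> h => /=.
  have h0 : h != 0 by near: h; exact: nbhs_dnbhs_neq.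
  have he : `|h| <= e by near: h; exact: dnbhs0_le.
  apply: le_trans he; rewrite [h *: 1]mulr1.
  have := sqrp_taylor t (h + t); rewrite addrK => H.
  rewrite -(ler_pM2l (_ : 0 < `|h|)) ?normr_gt0// -normrM -[leRHS]expr2 real_normK ?num_real//.
  apply: le_trans H; rewrite -normrN le_eqVlt; apply/orP; left; apply/eqP; congr Num.norm.
  by rewrite /GRing.scale /=; field.
apply: DeriveDef; first by apply/cvg_ex; exists (2 * Num.max 0 t).
exact: cvg_lim C.
Unshelve. all: by end_near. Qed.

Lemma sqrp_eq0 t : t <= 0 -> sqrp t = 0.
Proof. by move=> t0; rewrite /sqrp (max_idPl t0) expr0n. Qed.

Lemma sqrp_ge0 t : 0 <= sqrp t.
Proof. exact: sqr_ge0. Qed.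

Lemma sqrp_ge1 t : 1 <= t -> 1 <= sqrp t.
Proof.
by move=> t1; rewrite /sqrp (max_idPr _) ?(le_trans _ t1)// expr_ge1// (le_trans _ t1).
Qed.

Lemma sqrp_le1 t : t <= 1 -> sqrp t <= 1.
Proof.
move=> t1; rewrite /sqrp expr_le1// ?le_max ?lexx// ge_max t1 ler01//.
Qed.

Context {N k : nat}.
Variables (a : 'I_k -> 'rV[R]_N) (eps : R).
Hypothesis eps0 : 0 < eps.

(** At least 1 within distance eps of a pole, and 0 at distance sqrt 2 eps or
    more from all poles. *)
Definition bump (x : 'rV[R]_N) : R :=
  \sum_(i < k) sqrp (2 + - (eps ^+ 2)^-1 * enorm (x - a i) ^+ 2).

(** Vanishing where bump is at least 1 makes this a cutoff for all poles
    at once, even when the balls around different poles overlap. *)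
Definition cutoff (x : 'rV[R]_N) : R := sqrp (1 + - bump x).

(** The shape, with its null summands, is the one produced by the rules for
    C1dir. *)
Definition dcutoff (j : 'I_N) (x : 'rV[R]_N) : R :=
  2 * Num.max 0 (1 + - bump x) * (0 + - \sum_(i < k)
    (2 * Num.max 0 (2 + - (eps ^+ 2)^-1 * enorm (x - a i) ^+ 2) *
       (0 + (- (eps ^+ 2)^-1 * (2 * (x ord0 j - a i ord0 j)) +
             enorm (x - a i) ^+ 2 * 0)))).

Lemma C1dir_cutoff j : C1dir setT j cutoff (dcutoff j).
Proof.
have cm : continuous (fun t : R => 2 * Num.max 0 t).
  move=> t; apply: cvgM; first exact: cvg_cst.
  by apply: continuous_max; [exact: cvg_cst|exact: cvg_id].
apply: (C1dir_comp _ is_derive_sqrp cm).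
apply: C1dirD; first exact: C1dir_cst.
apply: C1dirN; apply: C1dir_sum => i.
apply: (C1dir_comp _ is_derive_sqrp cm).
apply: C1dirD; first exact: C1dir_cst.
apply: C1dirM; first exact: C1dir_cst.
exact: C1dir_enorm_sqr.
Qed.

Lemma bump_ge0 x : 0 <= bump x.
Proof. by apply: sumr_ge0 => i _; exact: sqrp_ge0. Qed.

Lemma cutoff_ge0 x : 0 <= cutoff x.
Proof. exact: sqrp_ge0. Qed.

Lemma cutoff_le1 x : cutoff x <= 1.
Proof. by apply: sqrp_le1; rewrite gerDl oppr_le0 bump_ge0. Qed.

Lemma cutoff_vanishes : vanishes_near (range a) cutoff.
Proof.
move=> _ [i _ <-].
have : \forall x \near a i, enorm (x - a i) < eps.
  apply: (@cvgr_lt _ _ (nbhs (a i)) _ (fun x : 'rV[R]_N => enorm (x - a i)) (enorm (a i - a i))).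
    exact: enorm_sub_continuous.
  by rewrite subrr -(scale0r 0) enormZ// mul0r.
apply: filterS => x xe; apply: sqrp_eq0; rewrite subr_le0 /bump (bigD1 i)//=.
rewrite -[leLHS]addr0; apply: lerD; last by apply: sumr_ge0 => j _; exact: sqrp_ge0.
apply: sqrp_ge1; have : (eps ^+ 2)^-1 * enorm (x - a i) ^+ 2 <= 1.
  rewrite ler_pdivrMl ?exprn_gt0// mulr1 ler_sqr ?nnegrE ?enorm_ge0 ?(ltW eps0)//.
  exact: ltW.
lra.
Qed.

Lemma bump_support x : (forall i, ~ cube (a i) (2 * eps) x) ->
  forall i, 2 + - (eps ^+ 2)^-1 * enorm (x - a i) ^+ 2 <= 0.
Proof.
move=> h i.
have : ~~ (enorm (x - a i) <= 2 * eps).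
  apply/negP => xe; apply: (h i); apply/ler_rV_norm.
    by rewrite mulr_ge0// ltW.
  by move=> j; apply: le_trans (coord_le_enorm _ _) xe.
rewrite -ltNge => xe.
have : 4 <= (eps ^+ 2)^-1 * enorm (x - a i) ^+ 2.
  rewrite ler_pdivlMl ?exprn_gt0//.
  have -> : eps ^+ 2 * 4 = (2 * eps) ^+ 2 by ring.
  by rewrite ler_sqr ?nnegrE ?enorm_ge0 ?ltW// mulr_gt0.
lra.
Qed.

Lemma cutoff_eq1 x : (forall i, ~ cube (a i) (2 * eps) x) -> cutoff x = 1.
Proof.
move=> /bump_support h; rewrite /cutoff /bump big1 => [|i _]; last exact: sqrp_eq0.
by rewrite oppr0 addr0 /sqrp (max_idPr _)// expr1n.
Qed.

Lemma dcutoff_eq0 j x : (forall i, ~ cube (a i) (2 * eps) x) -> dcutoff j x = 0.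
Proof.
move=> /bump_support h; rewrite /dcutoff big1 => [|i _]; first by rewrite oppr0 addr0 mulr0.
by rewrite (max_idPl (h i)) mulr0 mul0r.
Qed.

Lemma dcutoff_le j x : `|dcutoff j x| <= 32 * k%:R / eps.
Proof.
rewrite /dcutoff add0r normrM normrN normrM [`|2|]ger0_norm//.
rewrite (_ : 32 * k%:R / eps = 2 * (\sum_(i < k) 16 / eps)); last first.
  by rewrite sumr_const card_ord -mulr_natl; field; rewrite gt_eqF.
apply: (@ler_pM R) => //.
  rewrite ger_pMr// ger0_norm ?le_max ?lexx// ge_max ler01/=.
  by rewrite gerDl oppr_le0 bump_ge0.
apply: le_trans (ler_norm_sum _ _ _) _; apply: ler_sum => i _.
rewrite mulr0 addr0 add0r.
have [t0|t0] := lerP (2 + - (eps ^+ 2)^-1 * enorm (x - a i) ^+ 2) 0.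
  by rewrite mulr0 mul0r normr0 divr_ge0// ltW.
have e20 : 0 < eps ^+ 2 by rewrite exprn_gt0.
have xe : enorm (x - a i) <= 2 * eps.
  have : (eps ^+ 2)^-1 * enorm (x - a i) ^+ 2 <= 4 by lra.
  rewrite ler_pdivrMl// (_ : eps ^+ 2 * 4 = (2 * eps) ^+ 2); last ring.
  by rewrite ler_sqr ?nnegrE ?enorm_ge0// mulr_ge0// ltW.
have xj : `|x ord0 j - a i ord0 j| <= 2 * eps.
  by apply: le_trans xe; have := coord_le_enorm (x - a i) j; rewrite !mxE.
rewrite !normrM normrN [`|2|]ger0_norm// [`|(eps ^+ 2)^-1|]ger0_norm ?invr_ge0 ?(ltW e20)//.
rewrite (_ : 16 / eps = (2 * 2) * ((eps ^+ 2)^-1 * (2 * (2 * eps)))); last first.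
  by field; rewrite gt_eqF.
have e2' : 0 <= (eps ^+ 2)^-1 by rewrite invr_ge0 ltW.
apply: (@ler_pM R) => //; first by rewrite !mulr_ge0.
  rewrite ler_pM2l// ger0_norm ?(ltW t0)//.
  have : 0 <= (eps ^+ 2)^-1 * enorm (x - a i) ^+ 2.
    by rewrite mulr_ge0 ?invr_ge0 ?sqr_ge0.
  lra.
apply: ler_wpM2l; first by rewrite invr_ge0 ltW.
by rewrite ler_pM2l.
Qed.

End cutoff.

(** * Density of functions vanishing near the poles *)

Section nonneg_integral.
Context d (T : measurableType d) (R : realType) (mu : {measure set T -> \bar R}).
Implicit Types f g h : T -> R.

Lemma integral_le_lincomb (D : set T) f g h (c1 c2 A B : R) : measurable D ->
  measurable_fun setT f -> measurable_fun setT g -> measurable_fun setT h ->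
  0 <= c1 -> 0 <= c2 ->
  (forall x, D x -> 0 <= f x) -> (forall x, D x -> 0 <= g x) -> (forall x, D x -> 0 <= h x) ->
  (forall x, D x -> f x <= c1 * g x + c2 * h x) ->
  (\int[mu]_(x in D) (g x)%:E <= A%:E)%E -> (\int[mu]_(x in D) (h x)%:E <= B%:E)%E ->
  (\int[mu]_(x in D) (f x)%:E <= (c1 * A + c2 * B)%:E)%E.
Proof.
move=> mD mf mg mh c10 c20 f0 g0 h0 fgh gA hB.
have mE (F : T -> R) : measurable_fun setT F -> measurable_fun D (fun x => (F x)%:E).
  by move=> mF; apply/measurable_EFinP; exact: measurable_funTS.
apply: (@le_trans _ _ (\int[mu]_(x in D) (c1%:E * (g x)%:E + c2%:E * (h x)%:E))%E).
  apply: ge0_le_integral => //.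
  - exact: mE.
  - by apply: emeasurable_funD; apply: measurable_funeM; exact: mE.
rewrite ge0_integralD//.
- rewrite !ge0_integralZl//; [|exact: mE|exact: mE].
  by rewrite EFinD !EFinM; apply: leeD; apply: lee_wpmul2l.
- by move=> x Dx; rewrite -EFinM lee_fin mulr_ge0 ?g0.
- by apply: measurable_funeM; exact: mE.
- by move=> x Dx; rewrite -EFinM lee_fin mulr_ge0 ?h0.
- by apply: measurable_funeM; exact: mE.
Qed.

Lemma integral_le_indic_sum k (B : 'I_k -> set T) f (c b : R) :
  (forall i, measurable (B i)) -> (forall i, (mu (B i) <= b%:E)%E) -> 0 <= c ->
  measurable_fun setT f -> (forall x, 0 <= f x) ->
  (forall x, (forall i, ~ B i x) -> f x = 0) -> (forall x, f x <= c) ->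
  (\int[mu]_x (f x)%:E <= (k%:R * (c * b))%:E)%E.
Proof.
move=> mB Bb c0 mf f0 fB fc.
have mI i : measurable_fun [set: T] (fun x => c%:E * (\1_(B i) x)%:E)%E.
  by apply: measurable_funeM; apply/measurable_EFinP; exact: measurable_indic.
have I0 i x : (0 <= c%:E * (\1_(B i) x)%:E)%E by rewrite mule_ge0.
apply: (@le_trans _ _ (\int[mu]_x \sum_(i < k) (c%:E * (\1_(B i) x)%:E))%E).
  apply: ge0_le_integral => //.
  - by move=> x _; rewrite lee_fin.
  - exact/measurable_EFinP.
  - exact: emeasurable_sum.
  - move=> x _; have [[i Bx]|nB] := pselect (exists i, B i x).
      rewrite (bigD1 i)//= indicE mem_set// mule1; apply: (@le_trans _ _ c%:E).
        by rewrite lee_fin.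
      by rewrite leeDl// sume_ge0.
    rewrite fB ?sume_ge0// => i Bx; apply: nB; by exists i.
rewrite ge0_integral_sum//.
apply: (@le_trans _ _ (\sum_(i < k) (c * b)%:E)%E).
  apply: lee_sum => i _; rewrite ge0_integralZl//; last first.
    by apply/measurable_EFinP; exact: measurable_indic.
  by rewrite integral_indic// setIT EFinM; apply: lee_wpmul2l.
by rewrite sumEFin sumr_const card_ord mulr_natl.
Qed.

End nonneg_integral.

Section approximation.
Context {R : realType} {N k : nat}.
Variables (a : 'I_k -> 'rV[R]_N).
Hypothesis N3 : (3 <= N)%N.

Local Notation mu := (@lebesgue_rV R N).

Lemma C1dir_Ck1 (f : 'rV[R]_N -> R) (df : 'I_N -> 'rV[R]_N -> R) :
  (forall j, C1dir setT j f (df j)) -> Ck 1 setT f.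
Proof.
move=> h.
have j0 : 'I_N by apply: (@Ordinal N 0); exact: leq_trans N3.
split=> [x _|j]; first by have [] := h j0 x I.
have E : partial j f = df j by apply/funext => x; exact: C1dir_partial (h j) I.
split=> [x _|x _]; first by have [_ [] ] := h j x I.
by rewrite E; have [_ _] := h j x I.
Qed.

Lemma Ck1_continuous (f : 'rV[R]_N -> R) : Ck 1 setT f -> continuous f.
Proof. by move=> [cf _] x; exact: cf. Qed.

Lemma Ck1_partial_continuous (f : 'rV[R]_N -> R) j : Ck 1 setT f -> continuous (partial j f).
Proof. by move=> [_ /(_ j) [_ cf]] x; exact: cf. Qed.

Lemma measurable_enorm_sqr (G : 'rV[R]_N -> 'rV[R]_N) :
  (forall j, measurable_fun setT (fun x => G x ord0 j)) ->
  measurable_fun setT (fun x => enorm (G x) ^+ 2).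
Proof.
move=> mG; rewrite (_ : (fun x => _) = fun x => \sum_j G x ord0 j ^+ 2).
  by apply: measurable_sum => j; exact: measurable_funX.
by apply/funext => x; rewrite enorm_sqr.
Qed.

Lemma measurable_enorm_sqr_sub (G H : 'rV[R]_N -> 'rV[R]_N) :
  (forall j, measurable_fun setT (fun x => G x ord0 j)) ->
  (forall j, measurable_fun setT (fun x => H x ord0 j)) ->
  measurable_fun setT (fun x => enorm (G x - H x) ^+ 2).
Proof.
move=> mG mH; apply: (@measurable_enorm_sqr (fun x => G x - H x)) => j.
rewrite (_ : (fun x => _) = fun x => G x ord0 j - H x ord0 j).
  exact: measurable_funB.
by apply/funext => x; rewrite !mxE.
Qed.

Lemma enorm_sqrD_le (x y z : 'rV[R]_N) t : 0 < t ->
  enorm (x - z) ^+ 2 <= (1 + t) * enorm (x - y) ^+ 2 + (1 + t^-1) * enorm (y - z) ^+ 2.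
Proof.
move=> t0; rewrite !enorm_sqr !mulr_sumr -big_split/=; apply: ler_sum => j _; rewrite !mxE.
set p := x ord0 j - y ord0 j; set q := y ord0 j - z ord0 j.
have -> : x ord0 j - z ord0 j = p + q by rewrite /p /q; ring.
rewrite -subr_ge0.
rewrite (_ : _ - _ = (t * p - q) ^+ 2 / t); last by field; rewrite gt_eqF.
by rewrite divr_ge0 ?sqr_ge0// ltW.
Qed.

Lemma measurable_grad_coord (f : 'rV[R]_N -> R) j : Ck 1 setT f ->
  measurable_fun setT (fun x => grad f x ord0 j).
Proof.
move=> Cf; rewrite (_ : (fun x => _) = partial j f).
  by apply: continuous_measurable_rV; exact: Ck1_partial_continuous.
by apply/funext => x; rewrite mxE.
Qed.

(** With e the scale of the cutoff eta, the gradient of eta phi - phi is at most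
    K / e on the cubes of half side 2 e around the poles and 0 elsewhere, so its
    energy is at most N (K / e)^2 k (4 e)^N, which is O(e) since N >= 3. *)
Lemma test_function_approx phi delta : Ck 1 setT phi -> bounded_support phi -> 0 < delta ->
  exists psi, [/\ admissible (range a) psi,
    (\int[mu]_x (enorm (grad psi x - grad phi x) ^+ 2)%:E <= delta%:E)%E &
    (\int[mu]_x ((psi x - phi x) ^+ 2)%:E <= delta%:E)%E].
Proof.
move=> Cphi bphi d0.
have cphi := Ck1_continuous Cphi.
have [C0 C00 hC0] := bounded_support_bounded cphi bphi.
have [C1 C1_0 hC1] : exists2 C : R, 0 < C & forall j x, `|partial j phi x| <= C.
  have H j : exists C : R, 0 < C /\ forall x, `|partial j phi x| <= C.
    have [||C ? ?] := @bounded_support_bounded _ _ (partial j phi).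
    - exact: Ck1_partial_continuous.
    - exact: partial_bounded_support.
    - by exists C.
  have [C hC] := choice H.
  exists (\sum_j C j + 1); first by rewrite ltr_wpDl// sumr_ge0// => j _; rewrite ltW// (hC j).1.
  move=> j x; apply: le_trans ((hC j).2 x) _; rewrite (bigD1 j)//= -addrA lerDl addr_ge0//.
  by apply: sumr_ge0 => i _; rewrite ltW// (hC i).1.
pose K := C1 + C0 * (32 * k%:R).
have K0 : 0 < K by rewrite ltr_wpDr// !mulr_ge0// ltW.
(* K / e bounds the partial derivatives of eta phi - phi, and e K2 bounds the
   integrals to be made small; 4^N comes from the volume (4 e)^N of a cube. *)
pose K2 := (N%:R * K ^+ 2 + C0 ^+ 2) * (k%:R * 4 ^+ N) + 1.
have kN0 : 0 <= k%:R * 4 ^+ N :> R by rewrite mulr_ge0 ?exprn_ge0.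
have NK0 : 0 <= N%:R * K ^+ 2 by rewrite mulr_ge0 ?sqr_ge0.
have C02 : 0 <= C0 ^+ 2 by exact: sqr_ge0.
have K20 : 0 < K2 by apply: ltr_wpDl => //; apply: mulr_ge0 => //; exact: addr_ge0.
have [e e0 [e1 eK]] : exists2 e : R, 0 < e & e <= 1 /\ e * K2 <= delta.
  exists (Num.min 1 (delta / K2)); first by rewrite lt_min ltr01 divr_gt0.
  by rewrite ge_min lexx; split=> //; rewrite -ler_pdivlMr// ge_min lexx orbT.
pose eta := cutoff a e; pose deta := dcutoff a e.
pose psi x := eta x * phi x.
pose dpsi j x := eta x * partial j phi x + phi x * deta j x.
have hpsi j : C1dir setT j psi (dpsi j).
  by apply: C1dirM; [exact: C1dir_cutoff|exact: Ck1_C1dir].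
have Cpsi : Ck 1 setT psi := C1dir_Ck1 hpsi.
have cpsi := Ck1_continuous Cpsi.
have mB i : measurable (cube (a i) (2 * e)) by apply: measurable_cube; rewrite mulr_ge0// ltW.
have muB i : (mu (cube (a i) (2 * e)) <= (4 ^+ N * e ^+ N)%:E)%E.
  rewrite lebesgue_rV_cube ?mulr_ge0 ?(ltW e0)// lee_fin -exprMn mulrA -natrM//.
have eN : e ^+ N <= e ^+ 3 by rewrite ler_wiXn2l// ltW.
exists psi; split.
- split => //.
    by have [M h] := bphi; exists M => x /h; rewrite /psi => ->; rewrite mulr0.
  move=> x /(cutoff_vanishes e0); apply: filterS => y; rewrite /psi /eta => ->.
  by rewrite mul0r.
- apply: le_trans (integral_le_indic_sum mB muB (c := N%:R * (K / e) ^+ 2) _ _ _ _ _) _.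
  + by rewrite mulr_ge0 ?sqr_ge0.
  + by apply: measurable_enorm_sqr_sub => j; exact: measurable_grad_coord.
  + by move=> x; exact: sqr_ge0.
  + move=> x hx; rewrite enorm_sqr big1// => j _; rewrite !mxE.
    rewrite (C1dir_partial (hpsi j))// /dpsi /eta /deta cutoff_eq1// dcutoff_eq0//.
    by rewrite mul1r mulr0 addr0 subrr expr0n.
  + move=> x; rewrite enorm_sqr -[N in N%:R]card_ord -sumr_const mulr_suml.
    apply: ler_sum => j _; rewrite mul1r !mxE (C1dir_partial (hpsi j))//.
    rewrite -real_normK ?num_real// ler_sqr ?nnegrE ?divr_ge0 ?(ltW K0) ?(ltW e0)//.
    rewrite /dpsi -/eta.
    have -> : eta x * partial j phi x + phi x * deta j x - partial j phi x =
       (eta x - 1) * partial j phi x + phi x * deta j x by ring.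
    apply: le_trans (ler_normD _ _) _; rewrite [X in X + _ <= _]normrM [X in _ + X <= _]normrM.
    rewrite /K mulrDl; apply: lerD.
      apply: (@le_trans _ _ C1); last by rewrite ler_pdivlMr// ger_pMr.
      rewrite -[leRHS]mul1r; apply: (@ler_pM R) => //.
      rewrite distrC ger0_norm ?subr_ge0 ?cutoff_le1// lerBlDr lerDl.
      exact: cutoff_ge0.
    rewrite -[leRHS]mulrA; apply: (@ler_pM R) => //.
    exact: dcutoff_le.
  + rewrite lee_fin; apply: le_trans eK.
    have -> : k%:R * (N%:R * (K / e) ^+ 2 * (4 ^+ N * e ^+ N)) =
       N%:R * K ^+ 2 * (k%:R * 4 ^+ N) * (e ^- 2 * e ^+ N).
      by field; rewrite gt_eqF.
    have eN' : e ^- 2 * e ^+ N <= e.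
      rewrite ler_pdivrMl ?exprn_gt0//; apply: le_trans eN _.
      by rewrite (_ : e ^+ 2 * e = e ^+ 3)//; ring.
    rewrite (mulrC e); apply: ler_pM => //.
    * exact: mulr_ge0.
    * by rewrite mulr_ge0 ?invr_ge0 ?exprn_ge0 ?(ltW e0).
    * by rewrite /K2 mulrDl -addrA lerDl addr_ge0// mulr_ge0.
- apply: le_trans (integral_le_indic_sum mB muB (c := C0 ^+ 2) _ _ _ _ _) _.
  + exact: sqr_ge0.
  + apply: measurable_funX; apply: measurable_funB; exact: continuous_measurable_rV.
  + by move=> x; exact: sqr_ge0.
  + by move=> x hx; rewrite /psi /eta cutoff_eq1// mul1r subrr expr0n.
  + move=> x; rewrite -real_normK ?num_real// ler_sqr ?nnegrE ?(ltW C00)//.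
    rewrite /psi -[X in _ - X]mul1r -mulrBl normrM -[leRHS]mul1r.
    apply: (@ler_pM R) => //.
    rewrite distrC ger0_norm ?subr_ge0 ?cutoff_le1// lerBlDr lerDl.
    exact: cutoff_ge0.
  + rewrite lee_fin; apply: le_trans eK.
    have -> : k%:R * (C0 ^+ 2 * (4 ^+ N * e ^+ N)) =
       C0 ^+ 2 * (k%:R * 4 ^+ N) * e ^+ N by ring.
    have eN' : e ^+ N <= e.
      by apply: le_trans eN _; rewrite exprS ger_pMr// expr_le1// ltW.
    rewrite (mulrC e); apply: ler_pM => //.
    * exact: mulr_ge0.
    * by rewrite exprn_ge0 ?(ltW e0).
    * by rewrite /K2 (addrC (_ * _) (C0 ^+ 2)) mulrDl -addrA lerDl addr_ge0// mulr_ge0.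
Qed.

End approximation.

Section energy_closure.
Context {R : realType} {N k : nat}.
Variables (a : 'I_k -> 'rV[R]_N).
Hypothesis N3 : (3 <= N)%N.

Local Notation mu := (@lebesgue_rV R N).

Lemma Lnorm_cvg0_integral (f : nat -> 'rV[R]_N -> R) (p : R) (gamma : R) : 0 < p -> 0 < gamma ->
  Lnorm mu p%:E (fun x => (f n x)%:E) @[n --> \oo] --> 0%E ->
  \forall n \near \oo, (\int[mu]_x (`|f n x| `^ p)%:E <= gamma%:E)%E.
Proof.
move=> p0 g0 cv.
have e0 : 0 < gamma `^ p^-1 by exact: powR_gt0.
have : \forall n \near \oo, (Lnorm mu p%:E (fun x => (f n x)%:E) < (gamma `^ p^-1)%:E)%E.
  apply: (cv [set y | (y < (gamma `^ p^-1)%:E)%E]).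
  by apply: open_nbhs_nbhs; split; [exact: open_ereal_lt_ereal|rewrite /= lte_fin].
apply: filterS => n /ltW le.
have <- : (Lnorm mu p%:E (fun x => (f n x)%:E) `^ p = \int[mu]_x (`|f n x| `^ p)%:E)%E.
  by rewrite poweR_Lnorm ?gt_eqF.
have -> : gamma%:E = ((gamma `^ p^-1)%:E `^ p)%E.
  by rewrite poweR_EFin -powRrM mulVf ?gt_eqF// powRr1// ltW.
apply: gt0_ler_poweR => //; first exact: ltW.
- by rewrite in_itv /= Lnorm_ge0 leey.
- by rewrite in_itv /= lee_fin leey andbT ltW.
Qed.

(** Compare t^2 with d^2 if |t| <= d and with a multiple of |t|^p otherwise; on a
    set of finite measure this makes the L^2 norm small when the L^p norm is. *)
Lemma sqr_le_powR (p d t : R) : 2 <= p -> 0 < d ->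
  t ^+ 2 <= d ^+ 2 + d ^+ 2 / d `^ p * `|t| `^ p.
Proof.
move=> p2 d0; have dp : 0 < d `^ p by exact: powR_gt0.
have [td|dt] := lerP `|t| d.
  rewrite -[leLHS]addr0; apply: lerD.
    rewrite -(real_normK (num_real t)) ler_sqr ?nnegrE ?(ltW d0)//.
  by apply: mulr_ge0; [apply: divr_ge0; [exact: sqr_ge0|exact: ltW]|exact: powR_ge0].
rewrite -[leLHS]add0r; apply: lerD; first exact: sqr_ge0.
have t0 : 0 < `|t| by exact: lt_trans dt.
rewrite -(real_normK (num_real t)) mulrAC ler_pdivlMr//.
rewrite -!powR_mulrn ?normr_ge0 ?(ltW d0)//.
have E (s : R) : 0 < s -> s `^ p = s `^ 2%:R * s `^ (p - 2).
  by move=> s0; rewrite -powRD ?(gt_eqF s0) ?implybT// addrC subrK.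
rewrite (E _ d0) (E _ t0) mulrCA.
rewrite ler_pM2l ?powR_gt0// ler_pM2l ?powR_gt0//.
by apply: ge0_ler_powR; rewrite ?nnegrE ?subr_ge0// ltW.
Qed.

Lemma sobolev_exponent_ge2 : 2 <= sobolev_exponent R N.
Proof.
have N3' : 3 <= N%:R :> R by rewrite (ler_nat _ 3).
rewrite /sobolev_exponent ler_pdivlMr; lra.
Qed.

Lemma D12_measurable_grad_coord (u : D12 R N) j :
  measurable_fun setT (fun x => D12_grad u x ord0 j).
Proof. exact ((measurable_fun_rVP (D12_grad u)).1 (D12_measurable_grad u) j). Qed.

Lemma measurable_grad_dist (u : D12 R N) psi : Ck 1 setT psi ->
  measurable_fun setT (fun x => enorm (grad psi x - D12_grad u x) ^+ 2).
Proof.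
move=> Cpsi; apply: measurable_enorm_sqr_sub => j.
  exact: measurable_grad_coord.
exact: D12_measurable_grad_coord.
Qed.

(** Only L^2 convergence on sets of finite measure is kept of the L^(2^* )
    convergence in D12_approx: it suffices to identify limits. *)
Lemma D12_approx_admissible (u : D12 R N) (E : set 'rV[R]_N) (delta : R) :
  measurable E -> (mu E < +oo)%E -> 0 < delta ->
  exists psi, [/\ admissible (range a) psi,
    (\int[mu]_x (enorm (grad psi x - D12_grad u x) ^+ 2)%:E <= delta%:E)%E &
    (\int[mu]_(x in E) ((psi x - u x) ^+ 2)%:E <= delta%:E)%E].
Proof.
move=> mE muE d0; have [phi [tphi gphi uphi]] := D12_approx u.
pose p := sobolev_exponent R N.
have p2 : 2 <= p := sobolev_exponent_ge2.
have p0 : 0 < p by apply: lt_le_trans p2.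
pose m := fine (mu E).
have mEE : mu E = m%:E by rewrite fineK// ge0_fin_numE.
have m0 : 0 <= m by exact: fine_ge0.
(* The choice of d makes the term d^2 of sqr_le_powR contribute at most
   delta / 8 on E, and c is the factor of |t|^p in that lemma. *)
pose d := Num.min 1 (delta / (8 * (m + 1))).
have dpos : 0 < d by rewrite lt_min ltr01 divr_gt0// mulr_gt0// ltr_wpDl.
have dm : d ^+ 2 * m <= delta / 8.
  have d1 : d <= 1 by rewrite ge_min lexx.
  have : d * (8 * (m + 1)) <= delta.
    by rewrite -ler_pdivlMr ?mulr_gt0 ?ltr_wpDl// ge_min lexx orbT.
  have : d ^+ 2 * m <= d * m by rewrite ler_wpM2r// expr2 ger_pMr.
  nra.
pose c := d ^+ 2 / d `^ p.
have c0 : 0 < c by rewrite divr_gt0 ?exprn_gt0 ?powR_gt0.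
have d4 : 0 < delta / 4 by rewrite divr_gt0.
have d8c : 0 < delta / 8 / c by rewrite divr_gt0// divr_gt0.
have nG := @Lnorm_cvg0_integral _ 2 (delta / 4) (ltr0Sn _ _) d4 gphi.
have nU := @Lnorm_cvg0_integral _ p (delta / 8 / c) p0 d8c uphi.
have [n [Gn Un]] : exists n,
  (\int[mu]_x (`|enorm (grad (phi n) x - D12_grad u x)| `^ 2)%:E <= (delta / 4)%:E)%E /\
  (\int[mu]_x (`|phi n x - u x| `^ p)%:E <= (delta / 8 / c)%:E)%E.
  by have [n [? ?]] := filter_ex (filterI nG nU); exists n.
have [Cphi kphi] := tphi n.
have C1phi : Ck 1 setT (phi n) := Cphi 1%N.
have bphi : bounded_support (phi n).
  have [M [_ hM]] := compact_bounded kphi; exists (M + 1) => x Mx.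
  apply/eqP/negPn/negP => fx.
  have : `|x| <= M + 1 by apply: hM; [rewrite ltrDl|exact: subset_closure].
  by rewrite leNgt Mx.
have [psi [apsi gpsi ppsi]] := test_function_approx a N3 C1phi bphi d4.
have C1psi : Ck 1 setT psi by case: apsi.
have mpsi := continuous_measurable_rV (Ck1_continuous C1psi).
have mphi := continuous_measurable_rV (Ck1_continuous C1phi).
have mu_ := @D12_measurable_fun _ _ u.
exists psi; split => //.
  have -> : delta = (1 + 1) * (delta / 4) + (1 + 1^-1) * (delta / 4) by rewrite invr1; field.
  apply: (integral_le_lincomb (g := fun x => enorm (grad psi x - grad (phi n) x) ^+ 2)
    (h := fun x => enorm (grad (phi n) x - D12_grad u x) ^+ 2)) => //.
  - exact: measurable_grad_dist.
  - by apply: measurable_enorm_sqr_sub => j; exact: measurable_grad_coord.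
  - exact: measurable_grad_dist.
  - by move=> x _; exact: sqr_ge0.
  - by move=> x _; exact: sqr_ge0.
  - by move=> x _; exact: sqr_ge0.
  - by move=> x _; exact: enorm_sqrD_le.
  - apply: le_trans Gn; under eq_integral => x _ do rewrite -powR_mulrn ?enorm_ge0// -[X in X `^ _]ger0_norm ?enorm_ge0//.
    by [].
have mpow : measurable_fun setT (fun x => `|phi n x - u x| `^ p).
  have mB : measurable_fun setT (fun x => phi n x - u x) by exact: measurable_funB.
  exact: (measurableT_comp (measurable_powR p) (measurableT_comp (@normr_measurable R setT) mB)).
have uE : (\int[mu]_(x in E) ((phi n x - u x) ^+ 2)%:E <= (delta / 4)%:E)%E.
  apply: (@le_trans _ _ (1 * (d ^+ 2 * m) + c * (delta / 8 / c))%:E); last first.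
    have -> : c * (delta / 8 / c) = delta / 8 by field; rewrite gt_eqF.
    by rewrite lee_fin; lra.
  apply: (integral_le_lincomb (g := fun=> d ^+ 2) (h := fun x => `|phi n x - u x| `^ p)) => //.
  - by apply: measurable_funX; exact: measurable_funB.
  - exact: ltW.
  - by move=> x _; exact: sqr_ge0.
  - by move=> x _; exact: sqr_ge0.
  - by move=> x _; rewrite mul1r; exact: sqr_le_powR.
  - by rewrite integral_cst// mEE.
  - apply: le_trans Un; apply: ge0_subset_integral => //.
    exact/measurable_EFinP.
have -> : delta = 2 * (delta / 4) + 2 * (delta / 4) by field.
apply: (integral_le_lincomb (g := fun x => (psi x - phi n x) ^+ 2)
    (h := fun x => (phi n x - u x) ^+ 2)) => //.
- by apply: measurable_funX; exact: measurable_funB.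
- by apply: measurable_funX; exact: measurable_funB.
- by apply: measurable_funX; exact: measurable_funB.
- by move=> x _; exact: sqr_ge0.
- by move=> x _; exact: sqr_ge0.
- by move=> x _; exact: sqr_ge0.
- move=> x _; rewrite -subr_ge0.
  rewrite (_ : _ - _ = ((psi x - phi n x) - (phi n x - u x)) ^+ 2); first exact: sqr_ge0.
  by ring.
- apply: le_trans ppsi; apply: ge0_subset_integral => //.
  + by apply/measurable_EFinP/measurable_funX; exact: measurable_funB.
  + by move=> x _; rewrite lee_fin sqr_ge0.
Qed.

End energy_closure.

(** * Hardy inequality in the energy space *)

Section hardy_D12.
Context {R : realType} {N k : nat}.
Variables (a : 'I_k -> 'rV[R]_N).
Hypothesis N3 : (3 <= N)%N.

Local Notation mu := (@lebesgue_rV R N).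

Lemma admissibleB S (f g : 'rV[R]_N -> R) : admissible S f -> admissible S g ->
  admissible S (fun x => f x + - g x) /\
  (forall x, grad (fun x => f x + - g x) x = grad f x - grad g x).
Proof.
move=> [Cf [M hM] vf] [Cg [M' hM'] vg].
have h j : C1dir setT j (fun x => f x + - g x) (fun x => partial j f x + - partial j g x).
  by apply: C1dirD; [exact: Ck1_C1dir|apply: C1dirN; exact: Ck1_C1dir].
split; last by move=> x; apply/rowP => j; rewrite !mxE (C1dir_partial (h j)).
split; first exact: C1dir_Ck1 h.
  exists (Num.max M M') => x; rewrite gt_max => /andP[/hM -> /hM' ->].
  by rewrite oppr0 addr0.
by move=> x Sx; apply: filterS2 (vf x Sx) (vg x Sx) => y -> ->; rewrite oppr0 addr0.
Qed.

(** On the set E M, which has finite measure and on which the weight is at most M,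
    replace u by an admissible psi' close to it in L^2 and apply the Hardy
    inequality to psi' - psi; the error tends to 0 as psi' tends to u, for fixed
    M.  The sets E M then exhaust the space. *)
Lemma hardy_D12 (u : D12 R N) i psi (delta : R) :
  admissible (range a) psi -> 0 <= delta ->
  (\int[mu]_x (enorm (grad psi x - D12_grad u x) ^+ 2)%:E <= delta%:E)%E ->
  (\int[mu]_x (hardy_weight (a i) x * (u x - psi x) ^+ 2)%:E <= (16 * delta)%:E)%E.
Proof.
move=> apsi delta0 gpsi.
pose w := hardy_weight (a i).
have w0 x : 0 <= w x by exact: hardy_weight_ge0.
have mw : measurable_fun setT w by exact: hardy_weight_measurable.
have C1psi : Ck 1 setT psi by case: apsi.
have mpsi := continuous_measurable_rV (Ck1_continuous C1psi).
have mu_ := @D12_measurable_fun _ _ u.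
have mf : measurable_fun setT (fun x => w x * (u x - psi x) ^+ 2).
  by apply: measurable_funM => //; apply: measurable_funX; exact: measurable_funB.
have f0 x : 0 <= w x * (u x - psi x) ^+ 2 by rewrite mulr_ge0 ?sqr_ge0.
pose E (M : nat) : set 'rV[R]_N := cube 0 M%:R `&` w @^-1` [set y | y <= M%:R].
have mE M : measurable (E M).
  apply: measurableI; first exact: measurable_cube.
  rewrite -[X in measurable X]setTI; apply: mw => //.
  rewrite (_ : [set y | y <= M%:R] = `]-oo, M%:R]%classic); first exact: measurable_itv.
  by apply/seteqP; split => y /=; rewrite in_itv.
have muE M : (mu (E M) < +oo)%E.
  apply: (@le_lt_trans _ _ (mu (cube 0 M%:R))).
    by apply: le_measure; rewrite ?inE//; [exact: measurable_cube|exact: subIsetl].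
  by rewrite lebesgue_rV_cube// ltry.
have bound M : (\int[mu]_(x in E M) (w x * (u x - psi x) ^+ 2)%:E <= (16 * delta)%:E)%E.
  apply/lee_addgt0Pr => e e0.
  (* so that the final error 2 M d + 16 d equals e *)
  pose d := e / (2 * M%:R + 16).
  have d0 : 0 < d by rewrite divr_gt0// ltr_wpDl// mulr_ge0.
  have [psi' [apsi' gpsi' upsi']] := D12_approx_admissible a N3 u (mE M) (muE M) d0.
  have C1psi' : Ck 1 setT psi' by case: apsi'.
  have mpsi' := continuous_measurable_rV (Ck1_continuous C1psi').
  have [aB gB] := admissibleB apsi' apsi.
  have [iw hw] := hardy_admissible N3 (ex_intro2 _ _ i I erefl : range a (a i)) aB.
  have gradB : (\int[mu]_x (enorm (grad psi' x - grad psi x) ^+ 2)%:E <= (2 * d + 2 * delta)%:E)%E.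
    apply: (integral_le_lincomb (g := fun x => enorm (grad psi' x - D12_grad u x) ^+ 2)
      (h := fun x => enorm (grad psi x - D12_grad u x) ^+ 2)) => //.
    - by apply: measurable_enorm_sqr_sub => j; exact: measurable_grad_coord.
    - exact: measurable_grad_dist.
    - exact: measurable_grad_dist.
    - by move=> x _; exact: sqr_ge0.
    - by move=> x _; exact: sqr_ge0.
    - by move=> x _; exact: sqr_ge0.
    - move=> x _; have := enorm_sqrD_le (grad psi' x) (D12_grad u x) (grad psi x) ltr01.
      rewrite invr1; congr (_ <= _ * _ + _ * _).
      by rewrite -(opprB (grad psi x)) !enorm_sqr; apply: eq_bigr => j _; rewrite !mxE sqrrN.
  have hwB : (\int[mu]_x (w x * (psi' x + - psi x) ^+ 2)%:E <= (4 * (2 * d + 2 * delta))%:E)%E.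
    rewrite intg_ge0_fin//; last by move=> x; rewrite mulr_ge0 ?sqr_ge0.
    rewrite lee_fin; apply: le_trans hw _; rewrite ler_pM2l//.
    under eq_Rintegral do rewrite gB.
    apply: (intg_ge0P _ _ gradB).2 => [|x]; last exact: sqr_ge0.
    by apply: measurable_enorm_sqr_sub => j; exact: measurable_grad_coord.
  apply: (@le_trans _ _ ((2 * M%:R) * d + 2 * (4 * (2 * d + 2 * delta)))%:E).
    apply: (integral_le_lincomb (g := fun x => (psi' x - u x) ^+ 2)
      (h := fun x => w x * (psi' x + - psi x) ^+ 2)) => //.
    - by apply: measurable_funX; exact: measurable_funB.
    - by apply: measurable_funM => //; apply: measurable_funX; exact: measurable_funB.
    - by move=> x _; exact: sqr_ge0.
    - by move=> x _; rewrite mulr_ge0 ?sqr_ge0.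
    - move=> x [_ /= wM].
      have h1 : w x * (psi' x - u x) ^+ 2 <= M%:R * (psi' x - u x) ^+ 2.
        by rewrite ler_wpM2r ?sqr_ge0.
      have h2 : 0 <= w x * ((psi' x - u x) + (psi' x + - psi x)) ^+ 2.
        by rewrite mulr_ge0 ?sqr_ge0.
      nra.
    - apply: le_trans hwB; apply: ge0_subset_integral => //.
      + apply/measurable_EFinP.
        by apply: measurable_funM => //; apply: measurable_funX; exact: measurable_funB.
      + by move=> x _; rewrite lee_fin mulr_ge0 ?sqr_ge0.
  rewrite -EFinD lee_fin.
  have -> : 2 * M%:R * d + 2 * (4 * (2 * d + 2 * delta)) = 16 * delta + d * (2 * M%:R + 16) by ring.
  by rewrite /d divfK// gt_eqF// ltr_wpDl// mulr_ge0.
have UE : \bigcup_M E M = setT.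
  apply/seteqP; split => // x _.
  exists (maxn (Num.truncn `|x|).+1 (Num.truncn (w x)).+1) => //; split.
    rewrite /cube /= subr0; apply: le_trans (ltW (truncnS_gt _)) _.
    by rewrite ler_nat leq_maxl.
  by rewrite /=; apply: le_trans (ltW (truncnS_gt _)) _; rewrite ler_nat leq_maxr.
have cv : (\int[mu]_(x in E M) (w x * (u x - psi x) ^+ 2)%:E)%E @[M --> \oo] -->
    (\int[mu]_(x in \bigcup_M E M) (w x * (u x - psi x) ^+ 2)%:E)%E.
  apply: ge0_nondecreasing_set_cvg_integral => //.
  - move=> m n mn; apply/subsetPset => x [xm wm].
    by split; [move: xm|move: wm]; rewrite /cube /= => /le_trans; apply; rewrite ler_nat.
  - by move=> M; apply/measurable_EFinP; exact: measurable_funTS.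
  - by move=> M x _; rewrite lee_fin.
rewrite -UE -(cvg_lim _ cv)//; apply: lime_le; first by apply/cvg_ex; eexists; exact: cv.
exact: nearW.
Qed.

End hardy_D12.

(** * Positivity of the quadratic form *)

Section perturbation.
Context {R : realType}.

(** Quadratic quantities at p and at q are compared at the cost of an arbitrarily
    small multiple of p^2, the rest being controlled by (p - q)^2. *)
Lemma sqr_perturb (p q t : R) : 0 < t ->
  `|q ^+ 2 - p ^+ 2| <= t * p ^+ 2 + (1 + t^-1) * (p - q) ^+ 2.
Proof.
move=> t0; have ti : 0 < t^-1 by rewrite invr_gt0.
have tt : t * t^-1 = 1 by rewrite divff// gt_eqF.
have h1 : 0 <= t^-1 * (t * p - (p - q)) ^+ 2 by rewrite mulr_ge0 ?sqr_ge0// ltW.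
have h2 : 0 <= t^-1 * (t * p + (p - q)) ^+ 2 by rewrite mulr_ge0 ?sqr_ge0// ltW.
have e1 : t^-1 * (t * p - (p - q)) ^+ 2 = t * p ^+ 2 - 2 * p * (p - q) + t^-1 * (p - q) ^+ 2.
  by field; rewrite gt_eqF.
have e2 : t^-1 * (t * p + (p - q)) ^+ 2 = t * p ^+ 2 + 2 * p * (p - q) + t^-1 * (p - q) ^+ 2.
  by field; rewrite gt_eqF.
have s := sqr_ge0 (p - q).
rewrite e1 in h1; rewrite e2 in h2.
rewrite ler_norml mulrDl mul1r.
have -> : q ^+ 2 - p ^+ 2 = (p - q) ^+ 2 - 2 * p * (p - q) by ring.
by apply/andP; split; lra.
Qed.

End perturbation.

Theorem proposition1p1 (R : realType) (N k : nat)
    (a : 'I_k -> 'rV[R]_N) (h : 'I_k -> 'rV[R]_N -> R) :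
  (3 <= N)%N -> (1 <= k)%N ->
  injective a ->
  (forall i, C1_sphere (h i)) ->
  (exists v : 'rV[R]_N -> R, positive_classical_solution a h v) ->
  forall u : D12 R N, 0 <= Qform a h u.
Proof.
move=> N3 _ _ hC [v hv] u.
pose mu := @lebesgue_rV R N.
pose V i := angular_potential (h i) (a i).
pose w i := hardy_weight (a i).
have w0 i x : 0 <= w i x by exact: hardy_weight_ge0.
have /choice [C hCb] : forall i, exists C : R, 0 < C /\ forall x, `|V i x| <= C * w i x.
  by move=> i; have [C C0 hCi] := angular_potential_bounded (hC i); exists C; split=> // x; exact: hCi.
have mw i : measurable_fun setT (w i) by exact: hardy_weight_measurable.
have mV i : measurable_fun setT (V i) by exact: angular_potential_measurable.
have mu_ := @D12_measurable_fun _ _ u.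
have approx (d : R) : 0 < d -> exists psi, [/\ admissible (range a) psi,
    mu.-integrable setT (EFin \o (fun x => enorm (grad psi x - D12_grad u x) ^+ 2)),
    \int[mu]_x (enorm (grad psi x - D12_grad u x) ^+ 2) <= d &
    forall i, mu.-integrable setT (EFin \o (fun x => w i x * (u x - psi x) ^+ 2)) /\
      \int[mu]_x (w i x * (u x - psi x) ^+ 2) <= 16 * d].
  move=> d0; have [||psi [apsi gpsi _]] := @D12_approx_admissible _ _ _ a N3 u set0 d _ _ d0.
  - exact: measurable0.
  - by rewrite measure0.
  have C1psi : Ck 1 setT psi by case: apsi.
  have mpsi := continuous_measurable_rV (Ck1_continuous C1psi).
  have [ig ig'] := intg_ge0P (measurable_grad_dist u C1psi) (fun x => sqr_ge0 _) gpsi.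
  exists psi; split => // i; apply: intg_ge0P.
  - by apply: measurable_funM => //; apply: measurable_funX; exact: measurable_funB.
  - by move=> x; rewrite mulr_ge0 ?sqr_ge0.
  - by apply: hardy_D12 => //; exact: ltW.
have mpsi psi : admissible (range a) psi -> measurable_fun setT psi.
  by move=> [C1psi _ _]; exact: continuous_measurable_rV (Ck1_continuous C1psi).
have iwpsi i psi : admissible (range a) psi ->
    mu.-integrable setT (EFin \o (fun x => w i x * psi x ^+ 2)).
  by move=> apsi; have [] := hardy_admissible N3 (ex_intro2 _ _ i I erefl : range a (a i)) apsi.
have iVpsi i psi : admissible (range a) psi ->
    mu.-integrable setT (EFin \o (fun x => V i x * psi x ^+ 2)).
  move=> apsi; apply: (intg_le _ (intgZ (C i) (iwpsi i psi apsi))) => [|x].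
    by apply: measurable_funM => //; apply: measurable_funX; exact: mpsi.
  by rewrite normrM mulrA [`|_ ^+ 2|]ger0_norm ?sqr_ge0// ler_wpM2r ?sqr_ge0 ?(hCb i).2.
(* One approximation at finite distance gives the integrability of the terms
   of the form at u. *)
have [psi0 [apsi0 ig0 _ iw0]] := approx 1 ltr01.
have mg : measurable_fun setT (fun x => enorm (D12_grad u x) ^+ 2).
  by apply: measurable_enorm_sqr; exact: D12_measurable_grad_coord.
have ig : mu.-integrable setT (EFin \o (fun x => enorm (D12_grad u x) ^+ 2)).
  apply: (intg_le mg (intgD (intgZ 2 (grad_sqr_intg apsi0)) (intgZ 2 ig0))) => x.
  rewrite ger0_norm ?sqr_ge0// !enorm_sqr !mulr_sumr -big_split /=.
  apply: ler_sum => j _; rewrite !mxE -subr_ge0.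
  rewrite (_ : _ - _ = (2 * partial j psi0 x - D12_grad u x ord0 j) ^+ 2); first exact: sqr_ge0.
  by ring.
have iwu i : mu.-integrable setT (EFin \o (fun x => w i x * u x ^+ 2)).
  apply: (intg_le _ (intgD (intgZ 2 (iwpsi i _ apsi0)) (intgZ 2 (iw0 i).1))) => [|x].
    by apply: measurable_funM => //; exact: measurable_funX.
  rewrite ger0_norm; last by rewrite mulr_ge0 ?sqr_ge0.
  rewrite -subr_ge0.
  rewrite (_ : _ - _ = w i x * (u x - 2 * psi0 x) ^+ 2); first by rewrite mulr_ge0 ?sqr_ge0.
  by ring.
have iVu i : mu.-integrable setT (EFin \o (fun x => V i x * u x ^+ 2)).
  apply: (intg_le _ (intgZ (C i) (iwu i))) => [|x].
    by apply: measurable_funM => //; exact: measurable_funX.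
  by rewrite normrM mulrA [`|_ ^+ 2|]ger0_norm ?sqr_ge0// ler_wpM2r ?sqr_ge0 ?(hCb i).2.
pose A := \int[mu]_x (enorm (D12_grad u x) ^+ 2).
pose U i := \int[mu]_x (w i x * u x ^+ 2).
have A0 : 0 <= A by apply: Rintegral_ge0 => x _; exact: sqr_ge0.
have U0 i : 0 <= U i by apply: Rintegral_ge0 => x _; rewrite mulr_ge0 ?sqr_ge0.
pose K1 := A + \sum_i C i * U i.
pose K2 := 1 + \sum_i C i * 16.
have K10 : 0 <= K1.
  by rewrite addr_ge0// sumr_ge0// => i _; rewrite mulr_ge0// ltW// (hCb i).1.
have K20 : 0 < K2.
  by rewrite ltr_pwDl// sumr_ge0// => i _; rewrite mulr_ge0// ltW// (hCb i).1.
(* The parameter t weighs u against u - psi in sqr_perturb, and d measures how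
   close psi is to u: let d tend to 0 first, then t. *)
have key (t d : R) : 0 < t -> 0 < d ->
    0 <= Qform a h u + t * K1 + (1 + t^-1) * (K2 * d).
  move=> t0 d0; have [psi [apsi igp gp wp]] := approx d d0.
  have Qpsi := Qform_admissible hC hv apsi.
  have t1 : 0 <= 1 + t^-1 by rewrite addr_ge0// invr_ge0 ltW.
  have grad_le : \int[mu]_x (enorm (grad psi x) ^+ 2) <= (1 + t) * A + (1 + t^-1) * d.
    apply: (@le_trans _ _ (\int[mu]_x ((1 + t) * enorm (D12_grad u x) ^+ 2 +
        (1 + t^-1) * enorm (grad psi x - D12_grad u x) ^+ 2))).
      apply: le_Rintegral => //.
      - exact: grad_sqr_intg apsi.
      - exact: intgD (intgZ _ ig) (intgZ _ igp).
      move=> x _; rewrite !enorm_sqr !mulr_sumr -big_split /=; apply: ler_sum => j _.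
      rewrite !mxE; have := sqr_perturb (D12_grad u x ord0 j) (partial j psi x) t0.
      rewrite ler_norml => /andP[_].
      rewrite (_ : (partial j psi x - _) ^+ 2 = (D12_grad u x ord0 j - partial j psi x) ^+ 2).
        by rewrite [(1 + t) * _]mulrDl mul1r; lra.
      by ring.
    rewrite RintegralD//; [|exact: intgZ|exact: intgZ].
    by rewrite !RintegralZl// lerD2l ler_wpM2l.
  have pot_ge i : \int[mu]_x (V i x * u x ^+ 2) -
      C i * (t * U i + (1 + t^-1) * (16 * d)) <= \int[mu]_x (V i x * psi x ^+ 2).
    have [iwd wd] := wp i.
    have Ci0 := ltW (hCb i).1.
    have irem := intgD (intgZ t (iwu i)) (intgZ (1 + t^-1) iwd).
    apply: (@le_trans _ _ (\int[mu]_x (V i x * u x ^+ 2 -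
       C i * (t * (w i x * u x ^+ 2) + (1 + t^-1) * (w i x * (u x - psi x) ^+ 2))))).
      rewrite RintegralB//; last exact: intgZ.
      rewrite lerD2l lerN2 RintegralZl// ler_wpM2l//.
      rewrite RintegralD//; [|exact: intgZ|exact: intgZ].
      by rewrite !RintegralZl// lerD2l ler_wpM2l.
    apply: le_Rintegral => //.
    - exact: intgB (iVu i) (intgZ _ irem).
    - exact: iVpsi.
    move=> x _; rewrite lerBlDr -lerBlDl.
    have -> : V i x * u x ^+ 2 - V i x * psi x ^+ 2 = - (V i x * (psi x ^+ 2 - u x ^+ 2)) by ring.
    apply: le_trans (ler_norm _) _; rewrite normrN normrM.
    apply: le_trans (ler_pM _ _ ((hCb i).2 x) (sqr_perturb (u x) (psi x) t0)) _ => //.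
    by rewrite le_eqVlt; apply/orP; left; apply/eqP; ring.
  have sum_ge : \sum_i \int[mu]_x (V i x * u x ^+ 2) -
      \sum_i C i * (t * U i + (1 + t^-1) * (16 * d)) <= \sum_i \int[mu]_x (V i x * psi x ^+ 2).
    by rewrite -sumrB; apply: ler_sum => i _; exact: pot_ge.
  have E : \sum_i C i * (t * U i + (1 + t^-1) * (16 * d)) =
      t * (\sum_i C i * U i) + (1 + t^-1) * ((\sum_i C i * 16) * d).
    rewrite mulr_suml !mulr_sumr -big_split /=; apply: eq_bigr => i _; ring.
  have QE : Qform a h u = A - \sum_i \int[mu]_x (V i x * u x ^+ 2) by [].
  move: Qpsi grad_le sum_ge; rewrite QE E /K1 /K2 -/mu.
  set X := \sum_i \int[mu]_x (V i x * u x ^+ 2).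
  set Y := \sum_i \int[mu]_x (V i x * psi x ^+ 2).
  set Z := \int[mu]_x _; set S1 := \sum_i C i * U i; set S2 := \sum_i _.
  rewrite !mulrDr !mulrDl !mul1r mulrDr; lra.
rewrite -[leRHS]addr0; apply/ler_addgt0Pr => e e0; rewrite addr0.
pose t := e / (2 * (K1 + 1)).
have t0 : 0 < t by rewrite divr_gt0// mulr_gt0// ltr_wpDl.
have t1 : 0 < 1 + t^-1 by rewrite addr_gt0// invr_gt0.
pose d := e / (2 * ((1 + t^-1) * K2)).
have d0 : 0 < d by rewrite divr_gt0// mulr_gt0// mulr_gt0.
apply: le_trans (key t d t0 d0) _; rewrite -addrA lerD2l.
have -> : (1 + t^-1) * (K2 * d) = e / 2.
  have P0 : 0 < (1 + t^-1) * K2 by rewrite mulr_gt0.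
  by rewrite mulrA /d; move: (_ * K2) P0 => P P0; field; rewrite gt_eqF.
have : t * K1 <= e / 2.
  have -> : e / 2 = t * (K1 + 1) by rewrite /t; field; rewrite gt_eqF// ltr_wpDl.
  by rewrite ler_wpM2l ?(ltW t0)// lerDl.
lra.
Qed.
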